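(* Let $0<r<1$, $\alpha>0$, $\beta\in\mathbb{R}$ and $n\in\mathbb{N}$. (i) For every $x\in\mathbb{R}$, every function $f\in C^{\alpha,r}_{\beta}L_{1}$ and every $n\ge n_{*}(\alpha,r,1)$ there is a real number $\gamma^{*}_{n,1}=\gamma^{*}_{n,1}(\alpha,r,\beta,f,x)$ with $|\gamma^{*}_{n,1}|<20\pi^{4}$ such that $$|\tilde\rho_n(f;x)|\le 2e^{-\alpha n^{r}}n^{1-r}\left|\sin\frac{2n-1}{2}x\right|\left(\frac{1}{\pi\alpha r}+\gamma^{*}_{n,1}\left(\frac{1}{(\alpha r)^2}\frac1{n^{r}}+\frac1{n^{1-r}}\right)\right)E_n(f^{\alpha,r}_{\beta})_{L_1}.$$ (ii) Moreover, for every $x\in\mathbb{R}$, every function $f\in C^{\alpha,r}_{\beta}L_{1}$ and every $n\ge n_{*}(\alpha,r,1)$ there exists a function $\mathcal{F}(\cdot)=\mathcal{F}(f;n;x,\cdot)\in C^{\alpha,r}_{\beta}L_{1}$ such that $E_n(\mathcal{F}^{\alpha,r}_{\beta})_{L_1}=E_n(f^{\alpha,r}_{\beta})_{L_1}$ and $$|\tilde\rho_n(\mathcal{F};x)|= 2e^{-\alpha n^{r}}n^{1-r}\left|\sin\frac{2n-1}{2}x\right|\left(\frac{1}{\pi\alpha r}+\gamma^{*}_{n,1}\left(\frac{1}{(\alpha r)^2}\frac1{n^{r}}+\frac1{n^{1-r}}\right)\right)E_n(f^{\alpha,r}_{\beta})_{L_1}$$ for some real number $\gamma^{*}_{n,1}=\gamma^{*}_{n,1}(\alpha,r,\beta,f,x)$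 (not necessarily the same as in (i)) with $|\gamma^{*}_{n,1}|<20\pi^{4}$.
   Context: Spaces. $L_1$ is the space of $2\pi$-periodic functions with $\|f\|_1=\int_0^{2\pi}|f(t)|\,dt<\infty$. Generalized Poisson integrals. For $\alpha,r>0$, $\beta\in\mathbb{R}$ let $P_{\alpha,r,\beta}(t)=\sum_{k=1}^{\infty}e^{-\alpha k^{r}}\cos\left(kt-\frac{\beta\pi}{2}\right)$. For $\mathfrak{N}\subset L_1$, $C^{\alpha,r}_{\beta}\mathfrak{N}$ is the set of $2\pi$-periodic functions $f$ representable for all $x\in\mathbb{R}$ as $$f(x)=\frac{a_0}{2}+\frac1\pi\int_{-\pi}^{\pi}P_{\alpha,r,\beta}(x-t)\varphi(t)\,dt,\quad a_0\in\mathbb{R},\ \varphi\in\mathfrak{N},\ \int_{-\pi}^{\pi}\varphi(t)\,dt=0.$$ The function $\varphi$ (determined up to a null set) is called the generalized derivative of $f$ and denoted $f^{\alpha,r}_{\beta}$. Interpolation polynomials. For a continuous $2\pi$-periodic $f$, $\tilde S_{n-1}(f;\cdot)$ is the unique trigonometric polynomial of order at most $n-1$ with $\tilde S_{n-1}(f;x_k^{(n-1)})=f(x_k^{(n-1)})$, $k=0,1,\dots,2n-2$, where $x_k^{(n-1)}=\frac{2k\pi}{2n-1}$. Put $\tilde\rho_n(f;x)=f(x)-\tilde S_{n-1}(f;x)$. Best approximation. $\mathcal{T}_{2n-1}$ is the space of trigonometric polynomials of order at most $n-1$, and $E_n(g)_{L_1}=\inf_{t_{n-1}\in\mathcal{T}_{2n-1}}\|g-t_{n-1}\|_1$.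 The number $n_*$. For $\alpha>0$, $r\in(0,1)$, $n_*(\alpha,r,1)$ is the smallest $n\in\mathbb{N}$ such that $$\frac{\ln(\pi n)}{\alpha r n^{r}}+\frac{\alpha r}{n^{1-r}}\le\frac1{14}.$$ *)

(* Defs.v *)
From HB Require Import structures.
From mathcomp Require Import all_boot all_order all_algebra.
From mathcomp Require Import all_classical all_reals all_analysis.
Set Implicit Arguments.
Unset Strict Implicit.
Unset Printing Implicit Defensive.
Import Order.TTheory GRing.Theory Num.Theory.
Import numFieldNormedType.Exports.
Local Open Scope classical_set_scope.
Local Open Scope ring_scope.

Section Definitions.
Variable R : realType.
Implicit Types (f g phi T : R -> R) (alpha r beta : R) (n m : nat).

Local Notation mu := (@lebesgue_measure R).

Definition L1 : set (R -> R) :=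
  [set g | periodic g (pi *+ 2) /\
           mu.-integrable `[0, pi *+ 2] (EFin \o g)].

Definition norm1 g : R := \int[mu]_(t in `[0, pi *+ 2]) `|g t|.

Definition poisson_kernel alpha r beta (t : R) : R :=
  \big[+%R/0]_(1 <= k <oo)
     (expR (- alpha * k%:R `^ r) * cos (k%:R * t - beta * pi / 2)).

(* A generalized derivative is determined only up to a null set, hence a
   relation between f and phi rather than a function of f. *)
Definition is_gen_deriv alpha r beta f phi : Prop :=
  [/\ L1 phi,
      \int[mu]_(t in `[- pi, pi]) phi t = 0 &
      exists a0 : R, forall x : R,
        f x = a0 / 2 + pi^-1 *
          \int[mu]_(t in `[- pi, pi]) (poisson_kernel alpha r beta (x - t) * phi t)].

Definition poisson_class alpha r beta (N : set (R -> R)) : set (R -> R) :=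
  [set f | periodic f (pi *+ 2) /\
           exists2 phi, N phi & is_gen_deriv alpha r beta f phi].

Definition trig_poly m : set (R -> R) :=
  [set T | exists a b : nat -> R, forall t : R,
     T t = a 0%N / 2 +
       \sum_(1 <= k < m.+1) (a k * cos (k%:R * t) + b k * sin (k%:R * t))].

Definition node n (k : nat) : R := 2 * k%:R * pi / (2 * n%:R - 1).

(* [get P] is the element of P when, as here for 0 < n, there is exactly one. *)
Definition trig_interp n f : R -> R :=
  get [set T | trig_poly n.-1 T /\
               forall k, (k < 2 * n - 1)%N -> T (node n k) = f (node n k)].

Definition interp_err n f (x : R) : R := f x - trig_interp n f x.

Definition best_approx n g : R :=
  inf [set norm1 (g \- T) | T in trig_poly n.-1].

Definition n_star_cond alpha r n : Prop :=
  (0 < n)%N /\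
  ln (pi * n%:R) / (alpha * r * n%:R `^ r) + alpha * r / n%:R `^ (1 - r)
    <= 14^-1.

Definition n_star alpha r : nat :=
  get [set n | n_star_cond alpha r n /\
               forall m, n_star_cond alpha r m -> (n <= m)%N].

End Definitions.

Arguments L1 {R}.
Arguments trig_poly {R} m.
Arguments node {R} n k.

(* Main.v *)
Require Import Defs.
From HB Require Import structures.
From mathcomp Require Import all_boot all_order all_algebra.
From mathcomp Require Import all_classical all_reals all_analysis.
From mathcomp Require Import measurable_realfun ring lra zify.
Set Implicit Arguments.
Unset Strict Implicit.
Unset Printing Implicit Defensive.
Import Order.TTheory GRing.Theory Num.Theory.
Import numFieldNormedType.Exports.
Local Open Scope classical_set_scope.
Local Open Scope ring_scope.

(**
  Interpolating [cos (k t + eta)] at the [2 n - 1] nodes aliases the frequency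
  [k] to [k - m (2 n - 1)], [m = (k + n - 1) / (2 n - 1)], so the error at [x]
  is an integral of [phi] against the kernel
    [sum_(k >= n) c_k (cos (k (x - t) - theta)
                       - cos (k (x - t) - theta - m (2 n - 1) x))],
  with [c_k = exp (- alpha k^r)] and [theta = beta pi / 2].  The k-th term is at
  most [2 |sin ((2 n - 1) x / 2)| k / n] and the kernel annihilates the
  trigonometric polynomials of order [< n]; hence the error is at most
  [2 / pi |sin ((2 n - 1) x / 2)| (sum_(k >= n) (k / n) c_k) E_n(phi)].
  Telescoping [t^(2 - r) exp (- alpha t^r)] and [t^(1 - r) exp (- alpha t^r)]
  shows that both [sum_(k >= n) (k / n) c_k] and [sum_(k >= n) c_k] are
  [c_n n^(1 - r) / (alpha r) (1 + O(Q))] where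
  [Q = alpha r / n^(1 - r) + 1 / (alpha r n^r)]; this only needs
  [alpha r n^r >= 4], which unlike the inequality defining [n_star] is
  preserved when [n] grows.
  For the lower bound the extremal derivative is a multiple of a Fejer kernel of
  order [n^2], centred at a point where the phases of the leading terms align;
  up to a constant it has L1 norm [2 pi], which bounds its best approximation.
  If [37 Q >= 1] there is nothing to prove, as [f] itself may be taken.
*)

(** * Tails of [exp (- alpha k^r)] *)

Section PowerExp.
Context {R : realType} (alpha r : R).
Hypotheses (r0 : 0 < r) (r1 : r < 1) (alpha0 : 0 < alpha).
Implicit Types (p t x y : R) (n k L : nat).

Definition powR_expR p t : R := t `^ p * expR (- alpha * t `^ r).

Local Notation c k := (expR (- alpha * k%:R `^ r)).

Lemma powR_expR_ge0 p t : 0 <= powR_expR p t.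
Proof. by rewrite mulr_ge0 ?powR_ge0 ?expR_ge0. Qed.

Lemma powR_expRD p q t : 0 < t -> powR_expR (p + q) t = t `^ p * powR_expR q t.
Proof. by move=> t0; rewrite /powR_expR powRD ?mulrA// (gt_eqF t0) implybT. Qed.

Lemma powR_expR0 t : powR_expR 0 t = expR (- alpha * t `^ r).
Proof. by rewrite /powR_expR powRr0 mul1r. Qed.

Lemma powR_expR1 t : 0 <= t -> powR_expR 1 t = t * expR (- alpha * t `^ r).
Proof. by move=> t0; rewrite /powR_expR powRr1. Qed.

Lemma is_derive_powR_expR p t : 0 < t ->
  is_derive t 1 (powR_expR p) ((p - alpha * r * t `^ r) * powR_expR (p - 1) t).
Proof.
move=> t0.
have h : is_derive t 1 (fun s => expR (- alpha * s `^ r))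
    (expR (- alpha * t `^ r) * (- alpha * (r * t `^ (r - 1)))).
  exact: (@is_derive1_comp R expR (fun s => - alpha * s `^ r) t _ _
    (is_derive_expR _) (is_deriveZ (- alpha) (is_derive1_powR r t0))).
have hM := @is_deriveM R R (fun s => s `^ p) (fun s => expR (- alpha * s `^ r)) t 1 _ _
  (is_derive1_powR p t0) h.
apply: (is_derive_eq hM).
rewrite /GRing.scale/= /powR_expR.
have -> : t `^ p = t * t `^ (p - 1).
  by rewrite -[X in X * _]powRr1 ?ltW// -powRD ?(gt_eqF t0) ?implybT//; congr powR; ring.
have -> : t `^ r = t * t `^ (r - 1).
  by rewrite -[X in X * _]powRr1 ?ltW// -powRD ?(gt_eqF t0) ?implybT//; congr powR; ring.
ring.
Qed.

Lemma powR_expR_MVT p (k : nat) : (0 < k)%N ->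
  exists2 x : R, k%:R <= x <= k.+1%:R &
    powR_expR p k.+1%:R - powR_expR p k%:R =
    (p - alpha * r * x `^ r) * powR_expR (p - 1) x.
Proof.
move=> k0.
have kS : k%:R <= k.+1%:R :> R by rewrite ler_nat.
have gt0 x : k%:R <= x -> 0 < x by apply: lt_le_trans; rewrite ltr0n.
have [||x x1 ->] := @MVT_segment R (powR_expR p)
   (fun x => (p - alpha * r * x `^ r) * powR_expR (p - 1) x) k%:R k.+1%:R kS.
- move=> x; rewrite in_itv/= => /andP[kx _].
  exact/is_derive_powR_expR/gt0/ltW.
- apply: derivable_within_continuous => x; rewrite in_itv/= => /andP[kx _].
  by apply: ex_derive; exact/is_derive_powR_expR/gt0.
by exists x; [by move: x1; rewrite in_itv|rewrite -natr1 addrAC subrr add0r mulr1].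
Qed.

Lemma ler_powR_nat q x y : 0 <= q -> 0 <= x -> x <= y -> x `^ q <= y `^ q.
Proof. by move=> q0 x0 xy; apply: ge0_ler_powR; rewrite ?nnegrE// (le_trans x0). Qed.

Lemma ler_powR_expR0 x y : 0 <= x -> x <= y ->
  expR (- alpha * y `^ r) <= expR (- alpha * x `^ r).
Proof.
move=> x0 xy; rewrite ler_expR !mulNr lerN2 ler_pM2l//.
by apply: ler_powR_nat => //; exact: ltW.
Qed.

(** The derivative of t exp(-alpha t^r) has the sign of 1 - alpha r t^r, which is nonpositive from
    [x] on. *)
Lemma powR_expR1_nonincr x y : 0 < x -> x <= y -> 1 <= alpha * r * x `^ r ->
  powR_expR 1 y <= powR_expR 1 x.
Proof.
move=> x0 xy ax.
have gt0 z : x <= z -> 0 < z by exact: lt_le_trans.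
have [||z zxy e] := @MVT_segment R (powR_expR 1)
   (fun x => (1 - alpha * r * x `^ r) * powR_expR (1 - 1) x) x y xy.
- move=> z; rewrite in_itv/= => /andP[kx _].
  exact/is_derive_powR_expR/gt0/ltW.
- apply: derivable_within_continuous => z; rewrite in_itv/= => /andP[kx _].
  by apply: ex_derive; exact/is_derive_powR_expR/gt0.
rewrite -subr_le0 e mulr_le0_ge0 ?subr_ge0// mulr_le0_ge0 ?powR_expR_ge0//.
rewrite subr_le0 (le_trans ax)// ler_pM2l ?mulr_gt0//.
move: zxy; rewrite in_itv/= => /andP[xz _].
by apply: ler_powR_nat => //; exact: ltW.
Qed.

Variable n : nat.
Hypotheses (n0 : (0 < n)%N) (an : 4 <= alpha * r * n%:R `^ r).

Let a := alpha * r * n%:R `^ r.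

Let a_le x : n%:R <= x -> a <= alpha * r * x `^ r.
Proof.
move=> nx; rewrite ler_pM2l ?mulr_gt0//.
by apply: ler_powR_nat => //; exact: ltW.
Qed.

(** At the mean value point x put b = alpha r x^r >= a. Minus the derivative of t^(2 - r) exp(-alpha
    t^r) is (b - 2 + r) / b times alpha r x exp(-alpha x^r), and b / (b - 2 + r) <= 1 + 4 / a
    because a >= 4. *)
Lemma powR_expR1_step (k : nat) : (n <= k)%N ->
  k.+1%:R * c k.+1 <= (1 + 4 / a) / (alpha * r) *
    (powR_expR (2 - r) k%:R - powR_expR (2 - r) k.+1%:R).
Proof.
move=> nk.
have k0 : (0 < k)%N by exact: leq_trans nk.
have [x /andP[kx xk] e] := powR_expR_MVT (2 - r) k0.
have nx : n%:R <= x by rewrite (le_trans _ kx)// ler_nat.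
have x0 : 0 < x by rewrite (lt_le_trans _ nx)// ltr0n.
have ax := a_le nx.
have a4 : 4 <= a by exact: an.
apply: (@le_trans _ _ (powR_expR 1 x)).
  rewrite -powR_expR1//.
  by apply: powR_expR1_nonincr => //; rewrite (le_trans _ ax)// (le_trans _ an)// ler1n.
rewrite -opprB e mulrN -mulNr [leRHS]mulrA.
have -> : powR_expR 1 x = x `^ r * powR_expR (2 - r - 1) x.
  by rewrite -powR_expRD//; congr powR_expR; ring.
have w0 := powR_expR_ge0 (2 - r - 1) x.
move: (powR_expR _ x) w0 => w w0.
apply: ler_wpM2r => //.
have arP : 0 < alpha * r by rewrite mulr_gt0.
set b := alpha * r * x `^ r in ax *.
have -> : x `^ r = b / (alpha * r) by rewrite /b mulrC mulKf ?gt_eqF.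
have -> : - ((1 + 4 / a) / (alpha * r)) * (2 - r - b) = (1 + 4 / a) * (b - 2 + r) / (alpha * r).
  by ring.
rewrite ler_pM2r ?invr_gt0//.
have a0 : 0 < a by rewrite (lt_le_trans _ a4).
have : b * a <= (a + 4) * (b - 2 + r).
  rewrite -subr_ge0.
  have -> : (a + 4) * (b - 2 + r) - b * a = 4 * (b - a) + 2 * (a - 4) + r * a + 4 * r by ring.
  by rewrite !addr_ge0 ?mulr_ge0 ?subr_ge0// ltW.
move=> h; rewrite -(ler_pM2r a0) (le_trans h)// [leRHS]mulrAC ler_wpM2r//.
  by rewrite addr_ge0 ?(ltW r0)// subr_ge0 (le_trans _ ax)// (le_trans _ a4)// ler_nat.
by rewrite mulrDl mul1r divfK ?gt_eqF.
Qed.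

(** Telescopes the preceding step, which bounds the term of index k + 1; hence the first term stands
    apart. *)
Lemma sum_powR_expR1_le (L : nat) :
  \sum_(n <= k < L) k%:R * c k <= n%:R * c n
    + (1 + 4 / a) / (alpha * r) * powR_expR (2 - r) n%:R.
Proof.
have pos : 0 <= (1 + 4 / a) / (alpha * r).
  have a0 : 0 < a by rewrite (lt_le_trans _ an).
  by rewrite divr_ge0 ?addr_ge0 ?divr_ge0 ?mulr_ge0// ltW.
have [Ln|nL] := leqP L n.
  rewrite big_geq//; apply: addr_ge0; apply: mulr_ge0 => //.
  exact: powR_expR_ge0.
(* L becomes (n + m) + 1, so that the induction on m starts from the single term of index n. *)
rewrite -(subnKC nL) addSn.
suff : \sum_(n <= k < (n + (L - n.+1)).+1) k%:R * c k <= n%:R * c n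
    + (1 + 4 / a) / (alpha * r) *
      (powR_expR (2 - r) n%:R - powR_expR (2 - r) (n + (L - n.+1))%:R).
  move=> h; apply: (le_trans h); rewrite lerD2l ler_wpM2l// gerBl.
  exact: powR_expR_ge0.
elim: (L - n.+1)%N => [|m ih].
  by rewrite addn0 big_nat1 subrr mulr0 addr0.
rewrite addnS big_nat_recr/=; last by rewrite -addnS leq_addr.
have := powR_expR1_step (leq_addr m n).
move: (_ * expR _) (powR_expR _ (n + m).+1%:R) => u v h.
apply: le_trans (lerD ih h) _.
by rewrite -addrA -mulrDr addrA subrK.
Qed.

(** Minus the derivative of t^(1 - r) exp(-alpha t^r) is alpha r exp(-alpha t^r) less a nonnegative
    term, hence at most alpha r c_k on [k, k + 1]. *)
Lemma sum_powR_expR0_ge (L : nat) : (n <= L)%N ->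
  (powR_expR (1 - r) n%:R - powR_expR (1 - r) L%:R) / (alpha * r) <=
  \sum_(n <= k < L) c k.
Proof.
move=> /subnKC <-; elim: (L - n)%N => [|m ih].
  by rewrite addn0 big_geq// subrr mul0r.
rewrite addnS big_nat_recr/= ?leq_addr//.
apply: le_trans (lerD ih (_ : (powR_expR (1 - r) (n + m)%:R -
  powR_expR (1 - r) (n + m).+1%:R) / (alpha * r) <= _)).
  by rewrite -mulrDl addrA subrK.
have nm0 : (0 < n + m)%N by rewrite addn_gt0 n0.
have [x /andP[kx xk] e] := powR_expR_MVT (1 - r) nm0.
have nx : n%:R <= x by rewrite (le_trans _ kx)// ler_nat leq_addr.
have x0 : 0 < x by rewrite (lt_le_trans _ nx)// ltr0n.
have arP : 0 < alpha * r by rewrite mulr_gt0.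
rewrite ler_pdivrMr//.
apply: (@le_trans _ _ (powR_expR 0 x * (alpha * r))); last first.
  by rewrite ler_pM2r// powR_expR0; exact: ler_powR_expR0.
have -> : powR_expR 0 x = x `^ r * powR_expR (1 - r - 1) x.
  by rewrite -powR_expRD//; congr powR_expR; ring.
rewrite -opprB e -mulNr [leRHS]mulrAC; apply: ler_wpM2r; first exact: powR_expR_ge0.
by rewrite opprB [leRHS]mulrC gerBl subr_ge0 ltW.
Qed.

(** Makes the far end of the telescoped lower bound vanish. The function is at most k c_k, the
    general term of a series whose partial sums are already bounded. *)
Lemma powR_expR_cvg0 : powR_expR (1 - r) k%:R @[k --> \oo] --> (0 : R).
Proof.
have h : k%:R * c k @[k --> \oo] --> (0 : R).
  have : cvgn (series (fun k => k%:R * c k)).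
    apply: nondecreasing_is_cvgn.
      apply/nondecreasing_seqP => k; rewrite seriesSr lerDl.
      by rewrite mulr_ge0 ?expR_ge0.
    exists (\sum_(0 <= k < n) k%:R * c k + (n%:R * c n
      + (1 + 4 / a) / (alpha * r) * powR_expR (2 - r) n%:R)) => _ [L _ <-].
    rewrite seriesEnat/=; have [Ln|/ltnW nL] := leqP L n.
      rewrite (big_cat_nat _ Ln)//= -addrA lerDl addr_ge0//.
        by rewrite sumr_ge0// => k _; rewrite mulr_ge0 ?expR_ge0.
      by rewrite (le_trans _ (sum_powR_expR1_le n))// big_geq.
    rewrite (big_cat_nat _ nL)//= lerD2l.
    exact: sum_powR_expR1_le.
  exact: cvg_series_cvg_0.
apply: (@squeeze_cvgr _ _ _ _ (fun=> 0) _ _ _ _ _ h); last exact: cvg_cst.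
near=> k; rewrite powR_expR_ge0/= /powR_expR ler_wpM2r ?expR_ge0//.
rewrite -[leRHS]powRr1//; apply: ler_powR; last by rewrite gerBl ltW.
by rewrite ler1n; near: k; exact: nbhs_infty_gt.
Unshelve. all: by end_near. Qed.

End PowerExp.

(** * Consequences of the inequality defining [n_star] *)

Section NStar.
Context {R : realType} (alpha r : R).
Hypotheses (r0 : 0 < r) (r1 : r < 1) (alpha0 : 0 < alpha).

Lemma powR_nat_unbounded (q Z : R) : 0 < q ->
  exists m : nat, forall n, (m <= n)%N -> Z <= n%:R `^ q.
Proof.
move=> q0; exists (Num.bound (`|Z| `^ q^-1)) => n mn.
rewrite (le_trans (ler_norm Z))//.
have -> : `|Z| = (`|Z| `^ q^-1) `^ q by rewrite -powRrM mulVf ?gt_eqF// powRr1.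
apply: ler_powR_nat; [exact: ltW|exact: powR_ge0|].
have /ltW/le_trans := archi_boundP (powR_ge0 `|Z| q^-1); apply.
by rewrite ler_nat.
Qed.

(** This is ln z <= z - 1 at z = y^q. *)
Lemma ln_powR_le (y q : R) : 0 < y -> 0 < q -> ln y <= y `^ q / q.
Proof.
move=> y0 q0; rewrite ler_pdivlMr// mulrC -ln_powR.
have p0 : 0 < y `^ q by exact: powR_gt0.
have := @le_ln1Dx R (y `^ q - 1); rewrite [1 + _]addrC subrK => h.
by rewrite (le_trans (h _))// ?gerBl// ltrBDr addNr.
Qed.

Lemma n_star_cond_exists : exists n, n_star_cond alpha r n.
Proof.
have arP : 0 < alpha * r by rewrite mulr_gt0.
have r2 : 0 < r / 2 by rewrite divr_gt0.
(* Each summand gets half of 1/14. The logarithm is at most (pi n)^(r/2) / (r/2), which leaves a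
   factor n^(r/2) in the denominator. *)
have [m1 h1] := powR_nat_unbounded (28 * (pi `^ (r / 2) / (r / 2) / (alpha * r))) r2.
have [m2 h2] := @powR_nat_unbounded (1 - r) (28 * (alpha * r)) ltac:(by rewrite subr_gt0).
pose n := (maxn m1 m2).+1; exists n; split=> //.
have {}h1 := h1 n (leqW (leq_maxl _ _)).
have {}h2 := h2 n (leqW (leq_maxr _ _)).
have n0 : 0 < n%:R :> R by rewrite ltr0n.
have -> : 14^-1 = 28^-1 + 28^-1 :> R by lra.
apply: lerD; last first.
  by rewrite ler_pdivrMr ?powR_gt0// ler_pdivlMl.
have nr : n%:R `^ r = n%:R `^ (r / 2) * n%:R `^ (r / 2).
  by rewrite -powRD ?(gt_eqF n0) ?implybT//; congr powR; lra.
rewrite ler_pdivrMr ?mulr_gt0 ?powR_gt0//.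
apply: (le_trans (ln_powR_le _ r2)); first by rewrite mulr_gt0// pi_gt0.
rewrite powRM ?pi_ge0 ?ler0n// nr.
move: h1; set N := n%:R `^ (r / 2); set p := pi `^ (r / 2) => h1.
have N0 : 0 < N by rewrite powR_gt0.
have {}h1 : p / (r / 2) <= 28^-1 * (alpha * r) * N.
  move: h1; rewrite mulrA ler_pdivrMr// => h1.
  by rewrite -mulrA ler_pdivlMl// [leRHS]mulrC.
have := ler_wpM2r (ltW N0) h1.
by rewrite [leLHS]mulrAC -!mulrA.
Qed.

(** [n_star] is chosen by [get], which is meaningful only on an inhabited set; the least solution
    inhabits it. *)
Lemma n_starP : n_star_cond alpha r (n_star alpha r).
Proof.
have h : exists n, `[< n_star_cond alpha r n >].
  by have [n ?] := n_star_cond_exists; exists n; exact/asboolP.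
have : [set n | n_star_cond alpha r n /\
    forall m, n_star_cond alpha r m -> (n <= m)%N] !=set0.
  exists (ex_minn h); case: ex_minnP => m /asboolP cm hm; split=> // k ck.
  by apply: hm; exact/asboolP.
by move=> /getPex[].
Qed.

(** Equivalent to exp(1/2) <= 2, which follows from exp(-1/2) >= 1 - 1/2. *)
Lemma ln2_ge : 2^-1 <= ln 2 :> R.
Proof.
rewrite -(@expRK R 2^-1) ler_ln ?posrE ?expR_gt0//.
have := @expR_ge1Dx R (- 2^-1); rewrite expRN => h.
rewrite -[leLHS]invrK -[leRHS]invrK lef_pV2 ?posrE ?invr_gt0 ?expR_gt0//.
by rewrite (le_trans _ h)//; lra.
Qed.

(** Dropping the second summand at the threshold m leaves alpha r m^r >= 14 ln(pi m) >= 14 ln 2 >=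
    7, and n^r increases with n. *)
Lemma n_star_ge4 n : (n_star alpha r <= n)%N -> 4 <= alpha * r * n%:R `^ r.
Proof.
have [m0 hm] := n_starP.
move: (n_star alpha r) m0 hm => m m0 hm mn.
have arP : 0 < alpha * r by rewrite mulr_gt0.
have m1 : 1 <= m%:R :> R by rewrite ler1n.
have mP : 0 < m%:R :> R by rewrite ltr0n.
have am : 0 < alpha * r * m%:R `^ r by rewrite mulr_gt0// powR_gt0.
have : ln 2 <= ln (pi * m%:R) :> R.
  rewrite ler_ln ?posrE ?mulr_gt0// ?pi_gt0//.
  by have := ler_pM (ler0n _ 2) (ler0n _ 1) (@pi_ge2 R) m1; rewrite mulr1.
move=> /(le_trans ln2_ge) h2.
have hb : 0 <= alpha * r / m%:R `^ (1 - r) by rewrite divr_ge0 ?powR_ge0 ?ltW.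
have {hm hb} : ln (pi * m%:R) / (alpha * r * m%:R `^ r) <= 14^-1 by lra.
rewrite ler_pdivrMr// => h.
have : 4 <= alpha * r * m%:R `^ r by move: h h2; move: (_ * _ `^ _) (ln _) => u v; lra.
move=> /le_trans; apply.
rewrite ler_pM2l//; apply: ler_powR_nat; rewrite ?ler_nat//; exact: ltW.
Qed.
End NStar.

(** * The two tail sums compared with their leading term *)

Section SumBounds.
Context {R : realType} (alpha r : R).
Hypotheses (r0 : 0 < r) (r1 : r < 1) (alpha0 : 0 < alpha).
Variable n : nat.
Hypotheses (n0 : (0 < n)%N) (an : 4 <= alpha * r * n%:R `^ r).
Local Notation c k := (expR (- alpha * k%:R `^ r)).

Definition tail_main : R := c n * n%:R `^ (1 - r) / (alpha * r).
(** The relative error Q, equal to alpha r times the bracket that multiplies gamma in the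
    theorem. *)
Definition tail_error : R := alpha * r / n%:R `^ (1 - r) + 1 / (alpha * r * n%:R `^ r).

Lemma tail_main_gt0 : 0 < tail_main.
Proof. by rewrite divr_gt0 ?mulr_gt0 ?expR_gt0 ?powR_gt0 ?ltr0n. Qed.

Lemma tail_error_gt0 : 0 < tail_error.
Proof.
by rewrite addr_gt0 ?divr_gt0 ?mulr_gt0 ?powR_gt0 ?ltr0n.
Qed.

(** The isolated first term c_n is [tail_main] times alpha r / n^(1 - r), so the first part of
    [tail_error] absorbs it; the second part absorbs 4 / a. *)
Lemma sum_weighted_le L :
  \sum_(n <= k < L) k%:R / n%:R * c k <= tail_main * (1 + 4 * tail_error).
Proof.
have nP : 0 < n%:R :> R by rewrite ltr0n.
have arP : 0 < alpha * r by rewrite mulr_gt0.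
rewrite (eq_bigr (fun k => n%:R^-1 * (k%:R * c k))); last by move=> k _; ring.
rewrite -mulr_sumr ler_pdivrMl//.
apply: (le_trans (sum_powR_expR1_le r0 alpha0 n0 an L)).
have -> : powR_expR alpha r (2 - r) n%:R = n%:R * (n%:R `^ (1 - r) * c n).
  rewrite /powR_expR mulrA; congr (_ * _).
  rewrite -[X in X * _]powRr1 ?ltW// -powRD ?(gt_eqF nP) ?implybT//.
  by congr powR; lra.
have q0 : 0 < n%:R `^ (1 - r) by rewrite powR_gt0.
have b0 : 0 < n%:R `^ r by rewrite powR_gt0.
rewrite /tail_main /tail_error.
move: (c n) (expR_gt0 (- alpha * n%:R `^ r)) => e e0.
move: (n%:R `^ (1 - r)) q0 (n%:R `^ r) b0 => q q0 b b0.
rewrite -subr_ge0.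
have -> : n%:R * (e * q / (alpha * r) * (1 + 4 * (alpha * r / q + 1 / (alpha * r * b))))
  - (n%:R * e + (1 + 4 / (alpha * r * b)) / (alpha * r) * (n%:R * (q * e)))
  = 3 * (n%:R * e).
  by field; rewrite !gt_eqF.
by rewrite !mulr_ge0// ltW.
Qed.

Lemma tail_sum_cvg_ge (e : R) : 0 < e -> exists L0, forall L, (L0 <= L)%N ->
  tail_main - e <= \sum_(n <= k < L) c k.
Proof.
move=> e0.
have arP : 0 < alpha * r by rewrite mulr_gt0.
have /cvgrPdist_lt/(_ (e * (alpha * r))) := powR_expR_cvg0 r0 alpha0 n0 an.
move=> /(_ (mulr_gt0 e0 arP))[L1 _ hL1].
exists (maxn n L1) => L; rewrite geq_max => /andP[nL /hL1/=].
rewrite sub0r normrN ger0_norm ?powR_expR_ge0// => h.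
apply: le_trans (sum_powR_expR0_ge r0 r1 alpha0 n0 nL).
have -> : tail_main = powR_expR alpha r (1 - r) n%:R / (alpha * r).
  by rewrite /tail_main /powR_expR [X in X / _]mulrC.
by rewrite mulrBl lerD2l lerN2 ler_pdivrMr// ltW.
Qed.
End SumBounds.

(** * Trigonometric interpolation *)

Section TrigPoly.
Context {R : realType}.
Implicit Types (x t eta : R) (n m k : nat) (j q z : int) (g T : R -> R).

Lemma cosD2piz x z : cos (x + z%:~R * (pi *+ 2)) = cos x.
Proof.
case: z => k.
  by rewrite -pmulrn -mulr_natl mulr1 mulr_natl (periodicn (@cosD2pi R)).
rewrite NegzE mulrNz mulNr -[LHS](periodicn (@cosD2pi R) k.+1) -pmulrn -mulr_natl.
by congr cos; ring.
Qed.

Lemma sinD2piz x z : sin (x + z%:~R * (pi *+ 2)) = sin x.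
Proof. by rewrite -[LHS]cosBpihalf addrAC cosD2piz cosBpihalf. Qed.

Lemma trig_polyD m T1 T2 : trig_poly m T1 -> trig_poly m T2 -> trig_poly m (T1 \+ T2).
Proof.
move=> [a1 [b1 h1]] [a2 [b2 h2]]; exists (a1 \+ a2), (b1 \+ b2) => t /=.
rewrite h1 h2 addrACA -mulrDl; congr (_ + _).
by rewrite -big_split; apply: eq_bigr => k _ /=; ring.
Qed.

Lemma trig_polyZ m (c : R) T : trig_poly m T -> trig_poly m (fun t => c * T t).
Proof.
move=> [a [b h]]; exists (fun k => c * a k), (fun k => c * b k) => t /=.
rewrite h mulrDr mulrA; congr (_ + _).
by rewrite mulr_sumr; apply: eq_bigr => k _ /=; ring.
Qed.

Lemma trig_poly_cosn m k eta : (k <= m)%N -> trig_poly m (fun t => cos (k%:R * t + eta)).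
Proof.
move=> km; have [->|k0] := posnP k.
  (* The constant term is stored as a_0 / 2, whence the factor 2. *)
  exists (fun i => if i is 0%N then 2 * cos eta else 0), (fun=> 0) => t /=.
  rewrite mul0r add0r mulrAC divff ?mul1r ?pnatr_eq0//.
  by rewrite big_nat big1 ?addr0// => -[//|i] _; rewrite !mul0r addr0.
exists (fun i => if i == k then cos eta else 0),
  (fun i => if i == k then - sin eta else 0) => t.
rewrite (ltn_eqF k0) mul0r add0r.
rewrite (bigD1_seq k) ?iota_uniq//=; last by rewrite mem_index_iota k0 ltnS km.
rewrite big1 ?addr0; last by move=> i /negbTE ->; rewrite !mul0r addr0.
by rewrite eqxx cosD mulNr mulrC [sin _ * _]mulrC.
Qed.

Lemma trig_poly_cos m j eta : (`|j| <= m)%N -> trig_poly m (fun t => cos (j%:~R * t + eta)).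
Proof.
case: j => k km; first exact: trig_poly_cosn.
have -> : (fun t => cos ((Negz k)%:~R * t + eta)) = (fun t => cos (k.+1%:R * t + - eta)).
  by apply/funext => t; rewrite -cosN NegzE mulrNz -pmulrn; congr cos; ring.
exact: trig_poly_cosn.
Qed.

Lemma trig_poly_cst m (c : R) : trig_poly m (fun=> c).
Proof.
have -> : (fun=> c) = (fun t => c * cos (0%:R * t + 0)).
  by apply/funext => t; rewrite mul0r addr0 cos0 mulr1.
exact/trig_polyZ/trig_poly_cosn.
Qed.

Lemma trig_poly_sum m (I : Type) (s : seq I) (F : I -> R -> R) :
  (forall i, trig_poly m (F i)) -> trig_poly m (fun t => \sum_(i <- s) F i t).
Proof.
move=> hF; elim: s => [|i s ih].
  have -> : (fun t => \sum_(i <- [::]) F i t) = (fun=> 0).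
    by apply/funext => t; rewrite big_nil.
  exact: trig_poly_cst.
have -> : (fun t => \sum_(i <- i :: s) F i t) = F i \+ (fun t => \sum_(i <- s) F i t).
  by apply/funext => t; rewrite big_cons.
exact: trig_polyD.
Qed.

(** Induction for linear properties: shifted cosines span the space, a sine being a cosine shifted
    by pi / 2 and a constant having frequency 0. *)
Lemma trig_poly_ind m (P : (R -> R) -> Prop) :
  (forall T1 T2, P T1 -> P T2 -> P (T1 \+ T2)) ->
  (forall (c : R) T, P T -> P (fun t => c * T t)) ->
  (forall k eta, (k <= m)%N -> P (fun t => cos (k%:R * t + eta))) ->
  forall T, trig_poly m T -> P T.
Proof.
move=> hD hZ hc T [a [b /funext ->]].
have h0 : P (fun=> a 0%N / 2).
  have -> : (fun=> a 0%N / 2) = (fun t => (a 0%N / 2) * cos (0%:R * t + 0)).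
    by apply/funext => t; rewrite mul0r addr0 cos0 mulr1.
  exact/hZ/hc.
suff h l : (l <= m)%N -> P (fun t => a 0%N / 2 +
    \sum_(1 <= k < l.+1) (a k * cos (k%:R * t) + b k * sin (k%:R * t))).
  exact: h.
elim: l => [_|l ih lm].
  rewrite [X in P X](_ : _ = (fun=> a 0%N / 2))//.
  by apply/funext => t; rewrite big_geq// addr0.
rewrite [X in P X](_ : _ = (fun t => a 0%N / 2 +
    \sum_(1 <= k < l.+1) (a k * cos (k%:R * t) + b k * sin (k%:R * t))) \+
    ((fun t => a l.+1 * cos (l.+1%:R * t + 0)) \+
     (fun t => b l.+1 * cos (l.+1%:R * t - pi / 2)))).
  by apply: (hD _ _ (ih (ltnW lm))); apply: hD; apply: hZ; exact: hc.
by apply/funext => t /=; rewrite big_nat_recr//= addr0 cosBpihalf addrA.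
Qed.

End TrigPoly.

(** * Interpolation at equidistant nodes through the Dirichlet kernel *)

Section Lagrange.
Context {R : realType} (n : nat).
Hypothesis n0 : (0 < n)%N.
Implicit Types (x t u eta : R) (m k : nat) (j q z : int) (g T : R -> R).
Local Notation N := (2 * n - 1)%N.

Lemma natr_nodes : N%:R = 2 * n%:R - 1 :> R.
Proof. by rewrite natrB ?natrM// muln_gt0. Qed.

Lemma nodes_gt0 : (0 < N)%N.
Proof. lia. Qed.

Lemma nodeE k : node n k = k%:R * (pi *+ 2) / N%:R :> R.
Proof. by rewrite /node natr_nodes -mulr_natl; ring. Qed.

Lemma sin_pi_frac_neq0 q : q != 0 -> (`|q| < N)%N -> sin (q%:~R * (pi / N%:R)) != 0 :> R.
Proof.
have h k : (0 < k)%N -> (k < N)%N -> sin (k%:R * (pi / N%:R)) != 0 :> R.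
  move=> k0 kN; rewrite gt_eqF// sin_gt0_pi//.
  have NP : 0 < N%:R :> R by rewrite ltr0n nodes_gt0.
  have p0 := @pi_gt0 R; apply/andP; split; first by rewrite mulr_gt0 ?ltr0n ?divr_gt0.
  by rewrite mulrA ltr_pdivrMr// mulrC ltr_pM2l// ltr_nat.
case: q => [k|k] q0 qN.
  by apply: h => //; move: q0; rewrite lt0n; apply: contraNN => /eqP ->.
by rewrite NegzE mulrNz mulNr sinN oppr_eq0; exact: h.
Qed.

(** Multiplied by 2 sin(q pi / N) the sum telescopes, since consecutive nodes are 2 pi / N apart;
    the end terms differ by whole periods. *)
Lemma sum_cos_node q eta : q != 0 -> (`|q| < N)%N ->
  \sum_(i < N) cos (q%:~R * node n i + eta) = 0.
Proof.
move=> q0 qN; have s0 := sin_pi_frac_neq0 q0 qN.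
have NP : N%:R != 0 :> R by rewrite pnatr_eq0 -lt0n nodes_gt0.
pose gg i := sin (q%:~R * node n i + eta - q%:~R * (pi / N%:R)) : R.
apply: (mulfI s0); apply: (@mulfI _ 2); first by rewrite pnatr_eq0.
rewrite !mulr0 mulrA mulr_sumr -(big_mkord xpredT (fun i => 2 * sin _ * cos (q%:~R * node n i + eta))).
rewrite (eq_bigr (fun i => gg i.+1 - gg i)); last first.
  move=> i _; rewrite /gg !nodeE -natr1.
  rewrite (_ : _ + eta - _ = (q%:~R * (i%:R * (pi *+ 2) / N%:R) + eta) + q%:~R * (pi / N%:R)).
    by rewrite sinD sinB; ring.
  by rewrite -mulr_natl; field.
rewrite telescope_sumr// /gg nodeE -[in X in X - _](sinD2piz _ (- q)) nodeE mul0r mul0r mulr0.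
apply/eqP; rewrite subr_eq0; apply/eqP; congr sin; rewrite mulrNz -mulr_natl.
by field.
Qed.

(** This is 1 + 2 sum_(1 <= l < n) cos(l u), spread over the frequencies -(n - 1), ..., n - 1 so
    that discrete orthogonality applies to each term. *)
Definition dirichlet u : R := \sum_(l < N) cos ((l%:Z - n.-1%:Z)%:~R * u).

Definition node_interp g x : R :=
  \sum_(i < N) g (node n i) * (dirichlet (x - node n i) / N%:R).

(** The kernel is expanded and products become sums; discrete orthogonality keeps only the
    frequencies j and -j, each with weight 1/2. *)
Lemma node_interp_cos j eta x : (`|j| < n)%N ->
  node_interp (fun t => cos (j%:~R * t + eta)) x = cos (j%:~R * x + eta).
Proof.
move=> jn.
have NP : N%:R != 0 :> R by rewrite pnatr_eq0 -lt0n nodes_gt0.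
have half z b : (`|z| < N)%N -> \sum_(i < N) cos (z%:~R * node n i + b) =
    (if z == 0 then N%:R * cos b else 0) :> R.
  move=> zN; case: eqP => [->|/eqP z0]; last exact: sum_cos_node.
  rewrite (eq_bigr (fun=> cos b)); last by move=> i _; rewrite mul0r add0r.
  by rewrite sumr_const card_ord mulr_natl.
rewrite /node_interp (eq_bigr (fun i : 'I_N => \sum_(l < N) (2 * N%:R)^-1 *
   (cos ((j - (l%:Z - n.-1%:Z))%:~R * node n i + (eta + (l%:Z - n.-1%:Z)%:~R * x)) +
    cos ((j + (l%:Z - n.-1%:Z))%:~R * node n i + (eta - (l%:Z - n.-1%:Z)%:~R * x))))); last first.
  move=> i _; rewrite /dirichlet mulrA mulr_sumr mulr_suml; apply: eq_bigr => l _.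
  set p := (l%:Z - _).
  have -> : (j - p)%:~R * node n i + (eta + p%:~R * x) =
     (j%:~R * node n i + eta) + p%:~R * (x - node n i) :> R by rewrite intrD mulrNz; ring.
  have -> : (j + p)%:~R * node n i + (eta - p%:~R * x) =
     (j%:~R * node n i + eta) - p%:~R * (x - node n i) :> R by rewrite intrD; ring.
  move: (_ + eta) (p%:~R * _) => A B.
  by rewrite cosD cosB; field.
rewrite exchange_big/= (eq_bigr (fun l : 'I_N => 2^-1 *
    ((if j == l%:Z - n.-1%:Z then cos (eta + j%:~R * x) else 0) +
     (if j == - (l%:Z - n.-1%:Z) then cos (eta + j%:~R * x) else 0)))); last first.
  move=> l _; rewrite -mulr_sumr big_split/= !half; last 2 first.
  - by move: (ltn_ord l) jn n0; lia.
  - by move: (ltn_ord l) jn n0; lia.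
  rewrite subr_eq0 addr_eq0.
  set p := (l%:Z - n.-1%:Z).
  have hp : j = p -> cos (eta + p%:~R * x) = cos (eta + j%:~R * x) by move=> ->.
  have hm : j = - p -> cos (eta - p%:~R * x) = cos (eta + j%:~R * x).
    by move=> ->; rewrite mulrNz mulNr.
  by case: eqP => [/hp ->|_]; case: eqP => [/hm ->|_]; field.
have pick (F : R) (i0 : 'I_N) (P : pred 'I_N) : P =1 pred1 i0 ->
   \sum_(l < N) (if P l then F else 0) = F.
  by move=> hP; rewrite -big_mkcond (eq_bigl _ _ hP) big_pred1_eq.
(* The positions of j and -j in the kernel, whose numbering is shifted by n - 1. *)
have l1 : (absz (j + n.-1%:Z)%R < N)%N by lia.
have l2 : (absz (n.-1%:Z - j)%R < N)%N by lia.
rewrite -mulr_sumr big_split/= (pick _ (Ordinal l1)); last first.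
  by move=> l; apply/eqP/eqP => [e|->/=]; [apply: val_inj => /=|]; lia.
rewrite (pick _ (Ordinal l2)); last first.
  by move=> l; apply/eqP/eqP => [e|->/=]; [apply: val_inj => /=|]; lia.
by rewrite [eta + _]addrC; field.
Qed.

Lemma node_interp_trig_poly T x : trig_poly n.-1 T -> node_interp T x = T x.
Proof.
move: T; apply: trig_poly_ind.
- move=> T1 T2 h1 h2; rewrite /node_interp/= -h1 -h2 -big_split/=.
  by apply: eq_bigr => i _; rewrite mulrDl.
- move=> c T <-; rewrite /node_interp mulr_sumr.
  by apply: eq_bigr => i _ /=; rewrite !mulrA.
- by move=> k eta kn; apply: (@node_interp_cos k%:Z); move: kn n0; lia.
Qed.

(** Nodes and frequencies exchange roles: up to a phase independent of l, the l-th term of the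
    kernel at [node n k - node n i] is a cosine of frequency k - i at the l-th node. *)
Lemma node_interp_node g k : (k < N)%N -> node_interp g (node n k) = g (node n k).
Proof.
move=> kN; have NP : N%:R != 0 :> R by rewrite pnatr_eq0 -lt0n nodes_gt0.
have dk i : (i < N)%N -> dirichlet (node n k - node n i) = if i == k then N%:R else 0 :> R.
  move=> iN.
  have -> : dirichlet (node n k - node n i) = \sum_(l < N)
     cos ((k%:Z - i%:Z)%:~R * node n l + (k%:Z - i%:Z)%:~R * (- n.-1%:R * (pi *+ 2) / N%:R)) :> R.
    apply: eq_bigr => l _; rewrite !nodeE; congr cos.
    by rewrite !intrB -!pmulrn; field.
  case: eqP => [->|/eqP ik].
    rewrite subrr (eq_bigr (fun=> 1)); last by move=> l _; rewrite !mul0r addr0 cos0.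
    by rewrite sumr_const card_ord.
  by apply: sum_cos_node; [rewrite subr_eq0 eq_sym|]; lia.
rewrite /node_interp (bigD1 (Ordinal kN))//= big1 ?addr0.
  by rewrite dk// eqxx divff// mulr1.
by move=> i ik; rewrite dk// ifN ?mul0r ?mulr0.
Qed.

Lemma trig_poly_node_interp g : trig_poly n.-1 (node_interp g).
Proof.
apply: trig_poly_sum => i.
rewrite (_ : (fun t => _) = (fun t => (g (node n i) / N%:R) *
  \sum_(l < N) cos ((l%:Z - n.-1%:Z)%:~R * t + - ((l%:Z - n.-1%:Z)%:~R * node n i)))).
  apply/trig_polyZ/trig_poly_sum => l; apply: trig_poly_cos.
  by move: (ltn_ord l) n0; lia.
apply/funext => t; rewrite mulrA mulrAC; congr (_ * _).
by apply: eq_bigr => l _; rewrite mulrBr.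
Qed.

(** [node_interp] gives existence. It also gives uniqueness, as it depends only on the values at the
    nodes and reproduces every polynomial of order below n. *)
Lemma trig_interpE g : trig_interp n g = node_interp g.
Proof.
have : [set T | trig_poly n.-1 T /\
    forall k, (k < 2 * n - 1)%N -> T (node n k) = g (node n k)] !=set0.
  by exists (node_interp g); split; [exact: trig_poly_node_interp|exact: node_interp_node].
move=> /getPex; rewrite -/(trig_interp n g) => -[hT hk].
apply/funext => x; rewrite -(node_interp_trig_poly x hT).
by apply: eq_bigr => i _; rewrite hk.
Qed.

(** Lowering the frequency by a multiple of N changes no value at the nodes, and the reduced
    frequency is small enough to be reproduced. *)
Lemma node_interp_cos_alias k eta x :
  node_interp (fun t => cos (k%:R * t + eta)) x =
  cos (k%:R * x + eta - ((k + n.-1) %/ N)%:R * N%:R * x).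
Proof.
set m := ((k + n.-1) %/ N)%N.
have NP : N%:R != 0 :> R by rewrite pnatr_eq0 -lt0n nodes_gt0.
have jn : (absz (k%:Z - (m * N)%:Z)%R < n)%N.
  (* Adding n - 1 before dividing centres the remainder, so the frequency lands between -(n - 1) and
     n - 1. *)
  by have := divn_eq (k + n.-1) N; have := ltn_pmod (k + n.-1) nodes_gt0; rewrite -/m; lia.
have := node_interp_cos eta x jn; rewrite intrB -!pmulrn natrM => h.
rewrite [RHS](_ : _ = cos ((k%:R - m%:R * N%:R) * x + eta)); last by congr cos; ring.
rewrite -h; apply: eq_bigr => i _; congr (_ * _).
rewrite -(cosD2piz _ (- (m * i)%:Z)); congr cos.
by rewrite mulrNz -pmulrn natrM nodeE; field.
Qed.

End Lagrange.

(** * Integrals over a period *)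

Section PeriodicIntegral.
Context {R : realType}.
Local Notation mu := (@lebesgue_measure R).
Implicit Types (f g : R -> R) (a b x : R).

Lemma measurable_shift a :
  measurable_fun [set: measurableTypeR R] (fun x : measurableTypeR R => x + a : measurableTypeR R).
Proof.
apply: continuous_measurable_fun => x.
by apply: cvgD; [exact: cvg_id|exact: cvg_cst].
Qed.

(** Lebesgue measure is determined by half-open intervals, whose length a translation preserves. *)
Lemma lebesgue_measure_shift a (A : set (measurableTypeR R)) : measurable A ->
  mu A = pushforward mu (fun x : measurableTypeR R => x + a : measurableTypeR R) A.
Proof.
move: A; apply: (@lebesgue_measure_unique R (pushforward mu _)); first exact: measurable_shift.
move=> mS X [[x y] _ <-] /=; rewrite /pushforward.
have -> : (fun x : measurableTypeR R => x + a : measurableTypeR R) @^-1` `]x, y] =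
   [set` `]x - a, y - a]].
  by apply/seteqP; split => t /=; rewrite !in_itv/= ltrBlDr lerBrDr.
rewrite !lebesgue_measure_itv/= !lte_fin ltrD2r; case: ifP => // _.
by rewrite -!EFinB; congr EFin; ring.
Qed.

Lemma ge0_integral_shift a b c (f : R -> \bar R) :
  measurable_fun [set` `[b + a, c + a]] f -> (forall x, (0 <= f x)%E) ->
  (\int[mu]_(x in [set` `[(b + a)%R, (c + a)%R]]) f x = \int[mu]_(x in [set` `[b, c]]) f (x + a)%R)%E.
Proof.
move=> mf f0.
pose S (x : measurableTypeR R) : measurableTypeR R := x + a.
have mS : measurable_fun setT S by exact: measurable_shift.
pose m : {measure set (measurableTypeR R) -> \bar R} :=
  measure_function_pushforward__canonical__measure_function_Measure mu mS.
rewrite (@eq_measure_integral _ (measurableTypeR R) R _ m); last first.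
  by move=> A mA _; exact: lebesgue_measure_shift.
rewrite (@ge0_integral_pushforward _ _ _ _ _ S mS mu)//.
congr (integral _ _ _).
by apply/seteqP; split => t /=; rewrite !in_itv/= !lerD2r.
Qed.

(** [L1] and [norm1] live on [0, 2 pi] but convolutions on [-pi, pi]. Both periods contain [0, pi],
    so only this piece has to be moved. *)
Lemma periodic_ge0_integral_shift (f : R -> R) : L1 f ->
  (\int[mu]_(x in [set` `[pi, (pi *+ 2)%R]]) `|(f x)%:E| =
   \int[mu]_(x in [set` `[(- pi)%R, 0%R]]) `|(f x)%:E|)%E.
Proof.
move=> [pf intf]; have p0 := @pi_gt0 R.
have mf : measurable_fun [set` `[0, pi *+ 2]] f.
  by apply/measurable_EFinP; exact: measurable_int intf.
have -> : `[pi, pi *+ 2] = `[- pi + pi *+ 2, 0 + pi *+ 2] :> interval R.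
  by congr (Interval (BLeft _) (BRight _)); ring.
rewrite (@ge0_integral_shift (pi *+ 2) (- pi) 0 (fun x => `|(f x)%:E|%E))//.
  by apply: eq_integral => x _; rewrite pf.
apply: measurableT_comp => //; apply/measurable_EFinP; apply: measurable_funS mf => //.
by move=> x /=; rewrite !in_itv/= => /andP[h1 h2]; apply/andP; split; lra.
Qed.

Lemma periodic_integrableN f : L1 f -> mu.-integrable [set` `[- pi, 0]] (EFin \o f).
Proof.
move=> lf; have [pf intf] := lf; have p0 := @pi_gt0 R.
have mf : measurable_fun [set` `[0, pi *+ 2]] f.
  by apply/measurable_EFinP; exact: measurable_int intf.
apply/integrableP; split.
  apply/measurable_EFinP.
  have -> : f = f \o (fun x => x + pi *+ 2) by apply/funext => x /=; rewrite pf.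
  apply: (@measurable_comp _ _ _ (measurableTypeR R) (measurableTypeR R) (measurableTypeR R)
     [set` `[0, pi *+ 2]] f _ (fun x => x + pi *+ 2)) => //.
    by move=> _ /= [x + <-]; rewrite !in_itv/= => /andP[h1 h2]; apply/andP; split; lra.
  by apply: measurable_funTS; exact: measurable_shift.
rewrite /= -periodic_ge0_integral_shift//.
have /integrableP[_] : mu.-integrable [set` `[pi, pi *+ 2]] (EFin \o f).
  apply: integrableS intf => //.
  by move=> x /=; rewrite !in_itv/= => /andP[h1 h2]; apply/andP; split; lra.
by [].
Qed.

Lemma periodic_integrable f :
  L1 f -> mu.-integrable [set` `[- pi, pi]] (EFin \o f).
Proof.
move=> lf; have [pf intf] := lf; have p0 := @pi_gt0 R.
have i1 := periodic_integrableN lf.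
have i2 : mu.-integrable [set` `]0, pi]] (EFin \o f).
  apply: integrableS intf => //.
  by move=> x /=; rewrite !in_itv/= => /andP[h1 h2]; apply/andP; split; lra.
rewrite (_ : [set` `[- pi, pi]] = [set` `[- pi, 0]] `|` [set` `]0, pi]]).
  have /integrableP[m1 f1] := i1; have /integrableP[m2 f2] := i2.
  have mU : measurable_fun ([set` `[- pi, 0]] `|` [set` `]0, pi]]) (EFin \o f).
    by apply/measurable_funU.
  apply/integrableP; split=> //; rewrite ge0_integral_setU//.
  - exact: lte_add_pinfty.
  - exact: measurableT_comp.
  - rewrite disj_set2E; apply/eqP/seteqP; split=> x //=; rewrite !in_itv/=.
    by move=> [/andP[_ h1] /andP[h2 _]]; lra.
apply/seteqP; split => x /=; rewrite !in_itv/=.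
  move=> /andP[h1 h2]; have [x0|x0] := leP x 0; [left|right]; first by rewrite h1.
  by [].
by case=> /andP[h1 h2]; apply/andP; split; lra.
Qed.

Lemma periodic_norm1 f : L1 f -> norm1 f = \int[mu]_(t in [set` `[- pi, pi]]) `|f t|.
Proof.
have p0 := @pi_gt0 R.
have p1 : pi <= pi *+ 2 :> R by lra.
have p2 : - pi <= 0 :> R by lra.
have s1 : [set` `]pi, pi *+ 2]] `<=` [set` `[(0 : R), pi *+ 2]].
  by move=> x /=; rewrite !in_itv/= => /andP[? ?]; apply/andP; split; lra.
have s2 : [set` `]0, pi]] `<=` [set` `[(- pi : R), pi]].
  by move=> x /=; rewrite !in_itv/= => /andP[? ?]; apply/andP; split; lra.
move=> lf; have [pf intf] := lf.
have i0 := periodic_integrable lf.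
have i1 := integrable_norm intf; have i2 := integrable_norm i0.
have h1 := @Rintegral_itvB R (fun x => `|f x|) (BLeft 0) (BRight (pi *+ 2)) pi i1.
have h2 := @Rintegral_itvB R (fun x => `|f x|) (BLeft (- pi)) (BRight pi) 0 i2.
have {h1} /eqP : norm1 f - \int[mu]_(t in [set` `[0, pi]]) `|f t| =
   \int[mu]_(t in [set` `[pi, pi *+ 2]]) `|f t|.
  rewrite /norm1 h1 ?bnd_simp ?(ltW p0)//.
  by apply: Rintegral_itv_obnd_cbnd; apply: integrableS i1.
rewrite subr_eq => /eqP ->.
have {h2} /eqP : \int[mu]_(t in [set` `[- pi, pi]]) `|f t| -
    \int[mu]_(t in [set` `[- pi, 0]]) `|f t| =
   \int[mu]_(t in [set` `[0, pi]]) `|f t|.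
  rewrite h2 ?bnd_simp ?(ltW p0)//.
  by apply: Rintegral_itv_obnd_cbnd; apply: integrableS i2.
rewrite subr_eq => /eqP ->; rewrite addrC; congr (_ + _).
by rewrite /Rintegral; congr fine; exact: periodic_ge0_integral_shift.
Qed.

Lemma continuous_integrable f a b : continuous f -> mu.-integrable `[a, b] (EFin \o f).
Proof.
move=> cf; apply: continuous_compact_integrable; first exact: segment_compact.
exact: continuous_subspaceT.
Qed.

Lemma is_derive_sin_lin (k eta x : R) :
  is_derive x 1 (fun t => sin (k * t + eta)) (k * cos (k * x + eta)).
Proof.
have h : is_derive x 1 (fun t => k * t + eta) k.
  have h1 := @is_deriveZ R R R id k x 1 1 (is_derive_id _ _).
  have h2 := @is_deriveD R R R _ (cst eta) x 1 _ _ h1 (is_derive_cst _ _ _).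
  by apply: (is_derive_eq h2); rewrite addr0 /GRing.scale/= mulr1.
apply: (is_derive_eq (@is_derive1_comp R sin (fun t => k * t + eta) x _ _ (is_derive_sin _) h)).
by rewrite mulrC.
Qed.

Lemma continuous_cos_lin (k eta : R) : continuous (fun t => cos (k * t + eta)).
Proof.
move=> x; apply: continuous_comp; last exact: continuous_cos.
apply: cvgD; last exact: cvg_cst.
by apply: cvgM; [exact: cvg_cst|exact: cvg_id].
Qed.

Lemma Rintegral_cos (k : nat) (eta : R) : (0 < k)%N ->
  \int[mu]_(t in `[- pi, pi]) cos (k%:R * t + eta) = 0.
Proof.
move=> k0; have kP : k%:R != 0 :> R by rewrite pnatr_eq0 -lt0n.
pose F t : R := k%:R^-1 * sin (k%:R * t + eta).
have dF x : is_derive x 1 F (cos (k%:R * x + eta)).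
  have := @is_deriveZ R R R _ (k%:R^-1) x 1 _ (is_derive_sin_lin k%:R eta x).
  by move/is_derive_eq; apply; rewrite /GRing.scale/= mulKf.
have cF : continuous F.
  by move=> x; apply: differentiable_continuous; apply/derivable1_diffP; by case: (dF x).
rewrite /Rintegral (@continuous_FTC2 _ _ F).
- rewrite -EFinB/= /F -mulrBr -[X in sin X - _](subrK (- k%:R * pi + eta)).
  rewrite [X in sin X - _](_ : _ = - k%:R * pi + eta + (k%:Z)%:~R * (pi *+ 2)); last first.
    by rewrite -pmulrn -mulr_natl; ring.
  by rewrite sinD2piz mulrN mulNr subrr mulr0.
- by have := @pi_gt0 R; lra.
- exact/continuous_subspaceT/continuous_cos_lin.
- split=> [x _| |]; first by case: (dF x).
  + by apply: cvg_at_right_filter; exact: cF.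
  + by apply: cvg_at_left_filter; exact: cF.
- by move=> x _; rewrite derive1E; case: (dF x).
Qed.

Lemma Rintegral_cst_pi c : \int[mu]_(t in `[- pi, pi]) c = c * (pi *+ 2).
Proof.
rewrite Rintegral_cst//= lebesgue_measure_itv/= lte_fin.
by have p0 := @pi_gt0 R; rewrite ifT ?opprK//; lra.
Qed.

(** Dominated convergence with majorant B |f|. For a constant sequence it yields the integrability
    of a bounded function times f. *)
Lemma bounded_cvg_Rintegral (D : set (measurableTypeR R)) (h_ : nat -> R -> R) (h f : R -> R) (B : R) :
  measurable D -> mu.-integrable D (EFin \o f) ->
  (forall m, measurable_fun D (h_ m)) ->
  (forall m x, `|h_ m x| <= B) -> (forall x, h_ ^~ x @ \oo --> h x) ->
  mu.-integrable D (EFin \o (fun x => h x * f x)) /\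
  \int[mu]_(x in D) (h_ m x * f x) @[m --> \oo] --> \int[mu]_(x in D) (h x * f x).
Proof.
move=> mD intf mh hB hh.
have mf : measurable_fun D f by apply/measurable_EFinP; exact: measurable_int intf.
have mhf m : measurable_fun D (fun x => h_ m x * f x) by exact: measurable_funM.
have B0 : 0 <= B by apply: le_trans (hB 0%N 0).
have hf x : (fun m => h_ m x * f x) @ \oo --> h x * f x.
  by apply: cvgM; [exact: hh|exact: cvg_cst].
have [|||||i _ c] := @dominated_convergence _ _ _ mu D mD
   (fun m x => (h_ m x * f x)%:E) (EFin \o (fun x => h x * f x))
   (EFin \o (fun x => B * `|f x|)).
- by move=> m; apply/measurable_EFinP; exact: mhf.
- apply/measurable_EFinP.
  exact: (measurable_fun_cvg mhf (fun x _ => hf x)).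
- by apply: aeW => x _; apply: cvg_EFin; [exact: nearW|exact: hf].
- exact: (integrableZl mD B (integrable_norm intf)).
- apply: aeW => x m _ /=; rewrite normrM lee_fin ler_wpM2r//.
split=> //; apply: fine_cvg; rewrite /Rintegral fineK//.
exact: integrable_fin_num.
Qed.

End PeriodicIntegral.

Lemma cvg_sum_seq (R : realType) (T I : Type) (F : set_system T) (FF : Filter F)
    (s : seq I) (f : I -> T -> R) (l : I -> R) :
  (forall i, f i t @[t --> F] --> l i) ->
  \sum_(i <- s) f i t @[t --> F] --> \sum_(i <- s) l i.
Proof.
move=> h; elim: s => [|i s ih].
  rewrite (_ : (fun t => _) = (fun=> 0)); last by apply/funext => t; rewrite big_nil.
  by rewrite big_nil; exact: cvg_cst.
rewrite (_ : (fun t => _) = (fun t => f i t + \sum_(i <- s) f i t)).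
  by rewrite big_cons; apply: cvgD.
by apply/funext => t; rewrite big_cons.
Qed.

(** * Orthogonality of shifted cosines over a period *)

Section Orthogonality.
Context {R : realType}.
Local Notation mu := (@lebesgue_measure R).
Local Notation I := [set` `[- (pi : R), pi]].
Implicit Types (f g : R -> R).

Lemma Rintegral_sum (s : seq nat) (F : nat -> R -> R) :
  (forall i, mu.-integrable I (EFin \o F i)) ->
  mu.-integrable I (EFin \o (fun t => \sum_(i <- s) F i t)) /\
  \int[mu]_(t in I) (\sum_(i <- s) F i t) = \sum_(i <- s) \int[mu]_(t in I) F i t.
Proof.
move=> hF; elim: s => [|i s [ih1 ih2]].
  rewrite (_ : (fun t => _) = (fun=> 0)); last by apply/funext => t; rewrite big_nil.
  split; first by apply: continuous_integrable => x; exact: cvg_cst.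
  by rewrite big_nil Rintegral_cst_pi mul0r.
have e : (fun t => \sum_(i <- i :: s) F i t) = (fun t => F i t + \sum_(i <- s) F i t).
  by apply/funext => t; rewrite big_cons.
rewrite e big_cons -ih2 RintegralD//; split=> //.
exact: (integrableD _ (hF i) ih1).
Qed.

(** In the product-to-sum formula the frequency k + j is positive and integrates to 0, so only k = j
    contributes. *)
Lemma Rintegral_cosM (k j : nat) (a b : R) : (0 < k)%N ->
  \int[mu]_(t in I) (cos (k%:R * t + a) * cos (j%:R * t + b)) =
  if k == j then pi * cos (a - b) else 0.
Proof.
move=> k0.
have ci (q c : R) : mu.-integrable I (EFin \o (fun t => 2^-1 * cos (q * t + c))).
  apply: continuous_integrable => x; apply: cvgM; first exact: cvg_cst.
  exact: continuous_cos_lin.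
have cj (q c : R) : mu.-integrable I (EFin \o (fun t => cos (q * t + c))).
  by apply: continuous_integrable; exact: continuous_cos_lin.
have e (t : R) : cos (k%:R * t + a) * cos (j%:R * t + b) =
    2^-1 * cos ((k + j)%N%:R * t + (a + b)) + 2^-1 * cos ((k%:R - j%:R) * t + (a - b)).
  rewrite natrD.
  rewrite [in X in _ = X + _](_ : _ + (a + b) = (k%:R * t + a) + (j%:R * t + b)); last by ring.
  rewrite [in X in _ = _ + X](_ : _ + (a - b) = (k%:R * t + a) - (j%:R * t + b)); last by ring.
  by move: (_ + a) (_ + b) => A B; rewrite cosD cosB; field.
under eq_Rintegral do rewrite e.
rewrite RintegralD// !RintegralZl// Rintegral_cos ?addn_gt0 ?k0// mulr0 add0r.
case: eqP => [<-|/eqP kj].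
  rewrite subrr; under eq_Rintegral do rewrite mul0r add0r.
  by rewrite Rintegral_cst_pi; field.
have [kj'|jk] := leqP j k.
  by rewrite -natrB// Rintegral_cos ?mulr0// subn_gt0 ltn_neqAle eq_sym kj.
(* Here k - j is negative; evenness of the cosine turns it into a natural number. *)
have e2 (t : R) : cos ((k%:R - j%:R) * t + (a - b)) = cos ((j - k)%N%:R * t + (b - a)).
  by rewrite -cosN natrB ?(ltnW jk)//; congr cos; ring.
under eq_Rintegral do rewrite e2.
by rewrite Rintegral_cos ?mulr0// subn_gt0.
Qed.
End Orthogonality.

(** * The interpolation error *)

Section Alias.
Variable n : nat.
Hypothesis n0 : (0 < n)%N.
Local Notation N := (2 * n - 1)%N.

(** The m of the overview, for which k - m N lies between -(n - 1) and n - 1. *)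
Definition alias (k : nat) : nat := (k + n.-1) %/ N.

Lemma alias_small k : (k < n)%N -> alias k = 0%N.
Proof. by move=> kn; rewrite /alias divn_small//; lia. Qed.

(** For m >= 1, m (2 n - 1) <= k + n - 1 gives k - m n >= (m - 1) (n - 1) >= 0. This is the origin
    of the weight k / n. *)
Lemma alias_muln_le k : (n <= k)%N -> (alias k * n <= k)%N.
Proof.
move=> nk; have := leq_divM (k + n.-1) N; rewrite -/(alias k).
case: (alias k) => [|m] h //; nia.
Qed.

Lemma alias_gt0 k : (n <= k)%N -> (0 < alias k)%N.
Proof. by move=> nk; rewrite /alias divn_gt0; lia. Qed.
End Alias.

(** * The integral kernel of the interpolation error *)

Section Kernel.
Context {R : realType} (alpha r beta : R).
Hypotheses (r0 : 0 < r) (r1 : r < 1) (alpha0 : 0 < alpha).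
Local Notation mu := (@lebesgue_measure R).
Local Notation I := [set` `[- (pi : R), pi]].
Local Notation c k := (expR (- alpha * k%:R `^ r)).
Local Notation theta := (beta * pi / 2).
Implicit Types (f g phi : R -> R) (x t y : R).

Definition poisson_partial (M : nat) y : R :=
  \sum_(1 <= k < M) c k * cos (k%:R * y - theta).

(** From n = [n_star alpha r] on, c_k is at most (k / n) c_k, whose sums are bounded; only finitely
    many terms come before. *)
Lemma sum_expR_bounded : exists C, forall L, \sum_(1 <= k < L) c k <= C.
Proof.
have n0 : (0 < n_star alpha r)%N by case: (n_starP r0 r1 alpha0).
have an := n_star_ge4 r0 r1 alpha0 (leqnn (n_star alpha r)).
move: (n_star alpha r) n0 an => n n0 an.
have nP : 0 < n%:R :> R by rewrite ltr0n.
exists (\sum_(1 <= k < n) c k + tail_main alpha r n * (1 + 4 * tail_error alpha r n)) => L.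
have tail := sum_weighted_le r0 alpha0 n0 an L.
have [Ln|/ltnW nL] := leqP L n.
  apply: (@le_trans _ _ (\sum_(1 <= k < n) c k)).
    have [L1|L1] := leqP L 1%N.
      by rewrite [leLHS]big_geq// sumr_ge0// => k _; exact: expR_ge0.
    rewrite (big_cat_nat (ltnW L1) Ln)//= lerDl; apply: sumr_ge0 => k _.
    exact: expR_ge0.
  by rewrite lerDl (le_trans _ tail)// big_geq.
rewrite (big_cat_nat n0 nL)//= lerD2l (le_trans _ tail)//.
rewrite big_nat_cond [leRHS]big_nat_cond; apply: ler_sum => k /andP[/andP[nk _] _].
by rewrite ler_peMl ?expR_ge0// ler_pdivlMr// mul1r ler_nat.
Qed.

Lemma poisson_partial_bounded : exists C, forall M y, `|poisson_partial M y| <= C.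
Proof.
have [C hC] := sum_expR_bounded; exists C => M y.
apply: le_trans (hC M); apply: le_trans (ler_norm_sum _ _ _) _.
apply: ler_sum => k _; rewrite normrM ger0_norm ?expR_ge0//.
by rewrite ler_piMr ?expR_ge0// cos_max.
Qed.

Lemma poisson_partial_cvg y : poisson_partial ^~ y @ \oo --> poisson_kernel alpha r beta y.
Proof.
(* [poisson_kernel] is defined as a limit, so existence of the limit is all that is at stake. *)
suff h : cvgn (poisson_partial ^~ y) by exact: h.
rewrite /poisson_partial.
have [C hC] := sum_expR_bounded.
have cs : cvgn (series (fun k => c k)).
  rewrite -(is_cvg_series_restrict 1).
  apply: nondecreasing_is_cvgn.
    apply/nondecreasing_seqP => -[|k] /=.
      by rewrite big_geq// sumr_ge0// => k _; exact: expR_ge0.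
    by rewrite [leRHS]big_nat_recr//= lerDl expR_ge0.
  by exists C => _ [L _ <-] /=; exact: hC.
have : cvgn (series (fun k => c k * cos (k%:R * y - theta))).
  apply: normed_cvg; apply: (series_le_cvg _ _ _ cs) => k /=; [exact: normr_ge0|exact: expR_ge0|].
  by rewrite normrM ger0_norm ?expR_ge0// ler_piMr ?expR_ge0// cos_max.
by rewrite -(is_cvg_series_restrict 1).
Qed.

Lemma continuous_poisson_partial M y : continuous (fun t => poisson_partial M (y - t)).
Proof.
rewrite /poisson_partial => t; apply: cvg_sum_seq => k.
apply: cvgM; first exact: cvg_cst.
rewrite (_ : (fun t => _) = (fun t => cos (- k%:R * t + (k%:R * y - theta)))).
  rewrite (_ : cos _ = cos (- k%:R * t + (k%:R * y - theta))); last by congr cos; ring.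
  exact: continuous_cos_lin.
by apply/funext => s; congr cos; ring.
Qed.

Lemma poisson_conv_cvg phi y : mu.-integrable I (EFin \o phi) ->
  \int[mu]_(t in I) (poisson_partial M (y - t) * phi t) @[M --> \oo] -->
  \int[mu]_(t in I) (poisson_kernel alpha r beta (y - t) * phi t).
Proof.
move=> iphi; have [C hC] := poisson_partial_bounded.
have [|||||_ //] := @bounded_cvg_Rintegral R I (fun M t => poisson_partial M (y - t))
   (fun t => poisson_kernel alpha r beta (y - t)) phi C.
- exact: measurable_itv.
- by [].
- move=> m; apply: measurable_funTS; apply: continuous_measurable_fun.
  exact: continuous_poisson_partial.
- by move=> m t; exact: hC.
- by move=> t; exact: poisson_partial_cvg.
Qed.

Variable n : nat.
Hypothesis n0 : (0 < n)%N.
Local Notation N := (2 * n - 1)%N.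

Definition err_coef (x t : R) (k : nat) : R :=
  cos (k%:R * (x - t) - theta) - cos (k%:R * (x - t) - theta - (alias n k)%:R * N%:R * x).

Definition err_partial M x t : R := \sum_(1 <= k < M) c k * err_coef x t k.

(** Interpolation is linear, so it acts on each cosine separately, where aliasing gives its
    value. *)
Lemma err_partialE M x t : err_partial M x t =
  poisson_partial M (x - t) - node_interp n (fun y => poisson_partial M (y - t)) x.
Proof.
have -> : node_interp n (fun y => poisson_partial M (y - t)) x =
   \sum_(1 <= k < M) c k * node_interp n (fun y => cos (k%:R * y + (- k%:R * t - theta))) x.
  rewrite /node_interp (eq_bigr (fun k => \sum_(i < N) c k *
    (cos (k%:R * node n i + (- k%:R * t - theta)) * (dirichlet n (x - node n i) / N%:R)))).
    rewrite exchange_big/=; apply: eq_bigr => i _; rewrite mulr_suml.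
    by apply: eq_bigr => k _; rewrite [RHS]mulrA; congr (_ * cos _ * _); ring.
  by move=> k _; rewrite mulr_sumr.
rewrite -sumrB; apply: eq_bigr => k _; rewrite node_interp_cos_alias// -mulrBr.
by congr (_ * (cos _ - cos _)); rewrite /alias; ring.
Qed.

Lemma continuous_err_partial M x : continuous (err_partial M x).
Proof.
move=> t; apply: cvg_sum_seq => k; apply: cvgM; first exact: cvg_cst.
rewrite /err_coef; set d := _ * _ * x.
have e s : k%:R * (x - s) - theta = - k%:R * s + (k%:R * x - theta) by ring.
have e2 s : k%:R * (x - s) - theta - d = - k%:R * s + (k%:R * x - theta - d) by ring.
rewrite (_ : (fun t => _) = (fun s => cos (- k%:R * s + (k%:R * x - theta)) -
   cos (- k%:R * s + (k%:R * x - theta - d)))); last by apply/funext => s; rewrite e2 e.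
by rewrite e2 e; apply: cvgB; exact: continuous_cos_lin.
Qed.

(** Interpolation is a finite sum over the nodes, so it commutes with the integral and with the
    limit. The constant a0 / 2 cancels because the weights add up to 1. *)
Lemma interp_err_cvg f phi x : L1 phi -> is_gen_deriv alpha r beta f phi ->
  pi^-1 * \int[mu]_(t in I) (err_partial M x t * phi t) @[M --> \oo] --> interp_err n f x.
Proof.
move=> lphi [_ _ [a0 hf]]; have iphi := periodic_integrable lphi.
rewrite /interp_err trig_interpE//.
pose J M y := \int[mu]_(t in I) (poisson_partial M (y - t) * phi t).
pose w i := dirichlet n (x - node n i) / N%:R : R.
have iJ M y : mu.-integrable I (EFin \o (fun t => poisson_partial M (y - t) * phi t)).
  have [C hC] := poisson_partial_bounded.
  have [|||] // := @bounded_cvg_Rintegral R I (fun=> fun t => poisson_partial M (y - t))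
     (fun t => poisson_partial M (y - t)) phi C (measurable_itv _) iphi.
    move=> _; apply: measurable_funTS; apply: continuous_measurable_fun.
    exact: continuous_poisson_partial.
  by move=> t; exact: cvg_cst.
have sw : \sum_(i < N) w i = 1.
  have := node_interp_trig_poly n0 x (trig_poly_cst n.-1 1).
  by rewrite /node_interp => <-; apply: eq_bigr => i _; rewrite mul1r.
have -> : f x - node_interp n f x = pi^-1 *
   (\int[mu]_(t in I) (poisson_kernel alpha r beta (x - t) * phi t) -
    \sum_(i < N) \int[mu]_(t in I) (poisson_kernel alpha r beta (node n i - t) * phi t) * w i).
  rewrite /node_interp hf mulrBr mulr_sumr.
  rewrite [X in _ - X = _](_ : _ = a0 / 2 + \sum_(i < N) pi^-1 *
    (\int[mu]_(t in I) (poisson_kernel alpha r beta (node n i - t) * phi t) * w i)).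
    have aux (u v z : R) : u + v - (u + z) = v - z by ring.
    exact: aux.
  rewrite (_ : a0 / 2 = \sum_(i < N) a0 / 2 * w i); last by rewrite -mulr_sumr sw mulr1.
  rewrite -big_split/=; apply: eq_bigr => i _.
  by rewrite hf mulrDl; congr (_ + _); exact: (esym (mulrA _ _ _)).
have mI : measurable (I : set (measurableTypeR R)) by exact: measurable_itv.
have eJ M : \int[mu]_(t in I) (err_partial M x t * phi t) =
   J M x - \sum_(i < N) J M (node n i) * w i.
  have [i1 e1] := @Rintegral_sum R (iota 0 N) (fun i t => w i * (poisson_partial M (node n i - t) * phi t))
     (fun i => integrableZl mI (w i) (iJ M (node n i))).
  rewrite -(big_mkord xpredT (fun i => J M (node n i) * w i)) /index_iota subn0.
  rewrite (eq_bigr (fun i => \int[mu]_(t in I) (w i * (poisson_partial M (node n i - t) * phi t)))); last first.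
    by move=> i _; rewrite RintegralZl// mulrC.
  rewrite -e1 -RintegralB//; apply: eq_Rintegral => t _.
  rewrite err_partialE mulrBl; congr (_ - _); rewrite /node_interp mulr_suml.
  rewrite -[in RHS](subn0 N) -/(index_iota 0 N) big_mkord.
  by apply: eq_bigr => i _; rewrite /w; ring.
under eq_cvg do rewrite eJ.
apply: cvgM; first exact: cvg_cst.
apply: cvgB; first exact: poisson_conv_cvg.
apply: cvg_sum_seq => i; apply: cvgM; last exact: cvg_cst.
exact: poisson_conv_cvg.
Qed.

End Kernel.

Section TrigPolyL1.
Context {R : realType}.
Local Notation mu := (@lebesgue_measure R).
Implicit Types (f g T : R -> R) (m : nat).

Lemma trig_poly_continuous m T : trig_poly m T -> continuous T.
Proof.
move: T; apply: trig_poly_ind.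
- by move=> T1 T2 h1 h2 t; apply: cvgD; [exact: h1|exact: h2].
- by move=> a T h t; apply: cvgM; [exact: cvg_cst|exact: h].
- by move=> k eta _; exact: continuous_cos_lin.
Qed.

Lemma trig_poly_periodic m T : trig_poly m T -> periodic T (pi *+ 2).
Proof.
move: T; apply: trig_poly_ind.
- by move=> T1 T2 h1 h2 t /=; rewrite h1 h2.
- by move=> a T h t; rewrite h.
- move=> k eta _ t; rewrite (_ : _ + eta = k%:R * t + eta + (k%:Z)%:~R * (pi *+ 2)).
    by rewrite cosD2piz.
  by rewrite -pmulrn; ring.
Qed.

Lemma trig_poly_L1 m T : trig_poly m T -> L1 T.
Proof.
move=> hT; split; first exact: trig_poly_periodic hT.
exact/continuous_integrable/(trig_poly_continuous hT).
Qed.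

Lemma L1B f g : L1 f -> L1 g -> L1 (f \- g).
Proof.
move=> [pf intf] [pg intg]; split=> [t|]; first by rewrite /= pf pg.
exact: (integrableB _ intf intg).
Qed.

End TrigPolyL1.

(** * Best approximation in L1 *)

Section BestApprox.
Context {R : realType} (n : nat).
Implicit Types (g T : R -> R).

Lemma norm1_ge0 g : 0 <= norm1 g.
Proof. by apply: Rintegral_ge0. Qed.

Lemma best_approx_le g T : trig_poly n.-1 T -> best_approx n g <= norm1 (g \- T).
Proof.
move=> hT; apply: ge_inf; last by exists T.
by exists 0 => _ [S _ <-]; exact: norm1_ge0.
Qed.

Lemma le_best_approx g (y : R) :
  (forall T, trig_poly n.-1 T -> y <= norm1 (g \- T)) -> y <= best_approx n g.
Proof.
move=> h; apply: lb_le_inf; last by move=> _ [T hT <-]; exact: h.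
by exists (norm1 (g \- (fun=> 0))); exists (fun=> 0) => //; exact: trig_poly_cst.
Qed.

Lemma best_approx_ge0 g : 0 <= best_approx n g.
Proof. by apply: le_best_approx => T _; exact: norm1_ge0. Qed.

Lemma best_approx_ge g (y B : R) : 0 <= B ->
  (forall T, trig_poly n.-1 T -> y <= B * norm1 (g \- T)) -> y <= B * best_approx n g.
Proof.
rewrite le_eqVlt => /predU1P[<- h|B0 h].
  by rewrite mul0r -(mul0r (norm1 (g \- fun=> 0))) h//; exact: trig_poly_cst.
rewrite mulrC -ler_pdivrMr//; apply: le_best_approx => T /h.
by rewrite ler_pdivrMr// mulrC.
Qed.

Lemma best_approxZ_le (c : R) g : L1 g -> 0 < c ->
  best_approx n (fun t => c * g t) <= c * best_approx n g.
Proof.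
move=> lg c0; apply: best_approx_ge; first exact: ltW.
move=> T hT; apply: le_trans (best_approx_le _ (trig_polyZ c hT)) _.
rewrite /norm1 -RintegralZl//.
  rewrite le_eqVlt; apply/orP; left; apply/eqP; apply: eq_Rintegral => t _ /=.
  by rewrite -mulrBr normrM gtr0_norm.
apply: integrable_norm; exact: (L1B lg (trig_poly_L1 hT)).2.
Qed.

(** Approximants of g and of c g correspond by scaling; the reverse inequality is the direct one for
    the factor c^-1. *)
Lemma best_approxZ (c : R) g : L1 g -> 0 < c ->
  best_approx n (fun t => c * g t) = c * best_approx n g.
Proof.
move=> lg c0; apply/eqP; rewrite eq_le best_approxZ_le//=.
have lcg : L1 (fun t => c * g t).
  split=> [t|]; first by rewrite lg.1.
  by have := integrableZl (measurable_itv _ : measurable ([set` `[(0 : R), pi *+ 2]] : set (measurableTypeR R))) c lg.2.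
rewrite -ler_pdivlMl//.
have := @best_approxZ_le c^-1 _ lcg; rewrite invr_gt0 => /(_ c0).
by rewrite [X in best_approx _ X <= _](_ : _ = g)//; apply/funext => t; rewrite mulKf ?gt_eqF.
Qed.
End BestApprox.

(** * Upper bound for the error *)

Section ErrCoef.
Context {R : realType} (alpha r beta : R).
Hypotheses (r0 : 0 < r) (r1 : r < 1) (alpha0 : 0 < alpha).
Local Notation mu := (@lebesgue_measure R).
Local Notation I := [set` `[- (pi : R), pi]].
Local Notation c k := (expR (- alpha * k%:R `^ r)).
Local Notation theta := (beta * pi / 2).
Implicit Types (f g phi T : R -> R) (x t y u : R).
Variable n : nat.
Hypothesis n0 : (0 < n)%N.
Local Notation N := (2 * n - 1)%N.

Lemma norm_sin_natmul (m : nat) y : `|sin (m%:R * y)| <= m%:R * `|sin y|.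
Proof.
elim: m => [|m ih]; first by rewrite mul0r sin0 normr0 mul0r.
rewrite -natr1 !mulrDl !mul1r sinD (le_trans (ler_normD _ _))// !normrM lerD//.
  by rewrite (le_trans _ ih)// ler_piMr// cos_max.
by rewrite ler_piMl// cos_max.
Qed.

(** The product form isolates sin(m N x / 2), from which the factor |sin(N x / 2)| is drawn. *)
Lemma err_coefE x t k : err_coef beta n x t k =
  - 2 * sin (k%:R * (x - t) - theta - (alias n k)%:R * (N%:R / 2 * x)) *
    sin ((alias n k)%:R * (N%:R / 2 * x)).
Proof.
rewrite /err_coef; set y := _ * (N%:R / 2 * x).
rewrite (_ : _ * _ * x = y + y); last by rewrite /y; field.
set z := _ - theta.
rewrite [in LHS](_ : cos z = cos ((z - y) + y)); last by rewrite subrK.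
rewrite (_ : z - (y + y) = (z - y) - y); last by ring.
by move: (z - y) => w; rewrite cosD cosB; ring.
Qed.

Lemma err_coef_small x t k : (k < n)%N -> err_coef beta n x t k = 0.
Proof. by move=> kn; rewrite err_coefE alias_small// mul0r sin0 mulr0. Qed.

(** Combines |sin(m y)| <= m |sin y| with m <= k / n. *)
Lemma norm_err_coef_le x t k : (n <= k)%N ->
  `|err_coef beta n x t k| <= 2 * `|sin (N%:R / 2 * x)| * (k%:R / n%:R).
Proof.
move=> nk; have nP : 0 < n%:R :> R by rewrite ltr0n.
rewrite err_coefE !normrM normrN normr_nat.
apply: (@le_trans _ _ (2 * 1 * ((alias n k)%:R * `|sin (N%:R / 2 * x)|))).
  by rewrite !ler_pM ?mulr_ge0// ?ler_pM// ?sin_max// norm_sin_natmul.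
rewrite mulr1 -[leRHS]mulrA ler_pM2l// mulrC ler_wpM2l//.
by rewrite ler_pdivlMr// -natrM ler_nat alias_muln_le.
Qed.

Lemma norm_err_partial_le M x t : 4 <= alpha * r * n%:R `^ r ->
  `|err_partial alpha r beta n M x t| <= 2 * `|sin (N%:R / 2 * x)| *
    (tail_main alpha r n * (1 + 4 * tail_error alpha r n)).
Proof.
move=> an; have S0 := sum_weighted_le r0 alpha0 n0 an M.
apply: (@le_trans _ _ (2 * `|sin (N%:R / 2 * x)| * \sum_(n <= k < M) k%:R / n%:R * c k)); last first.
  by rewrite ler_wpM2l// mulr_ge0.
have B0 k : 0 <= k%:R / n%:R * c k by rewrite mulr_ge0 ?divr_ge0 ?expR_ge0.
have [Mn|/ltnW nM] := leqP M n.
  rewrite /err_partial big_nat_cond big1 ?normr0 ?mulr_ge0 ?sumr_ge0//.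
  by move=> k /andP[/andP[_ kM] _]; rewrite err_coef_small ?mulr0// (leq_trans kM).
rewrite /err_partial (big_cat_nat n0 nM)/= [X in X + _]big_nat_cond big1 ?add0r; last first.
  by move=> k /andP[/andP[_ kM] _]; rewrite err_coef_small ?mulr0.
apply: le_trans (ler_norm_sum _ _ _) _; rewrite mulr_sumr.
rewrite big_nat_cond [leRHS]big_nat_cond; apply: ler_sum => k /andP[/andP[nk _] _].
rewrite normrM ger0_norm ?expR_ge0// mulrA mulrC ler_wpM2r ?expR_ge0//.
exact: norm_err_coef_le.
Qed.

Lemma err_coef_lin x t k : err_coef beta n x t k =
  cos (k%:R * t + (theta - k%:R * x)) -
  cos (k%:R * t + (theta - k%:R * x + (alias n k)%:R * N%:R * x)).
Proof.
rewrite /err_coef -[X in X - _]cosN -[X in _ - X]cosN.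
by congr (cos _ - cos _); ring.
Qed.

Lemma continuous_err_coef x k : continuous (fun t => err_coef beta n x t k).
Proof.
rewrite (_ : (fun t => _) = (fun t => cos (k%:R * t + (theta - k%:R * x)) -
  cos (k%:R * t + (theta - k%:R * x + (alias n k)%:R * N%:R * x)))).
  by move=> t; apply: cvgB; exact: continuous_cos_lin.
by apply/funext => t; rewrite err_coef_lin.
Qed.

Lemma Rintegral_err_coef_cosM x (k j : nat) b : (0 < k)%N ->
  \int[mu]_(t in I) (err_coef beta n x t k * cos (j%:R * t + b)) =
  if k == j then pi * (cos (theta - k%:R * x - b) -
    cos (theta - k%:R * x + (alias n k)%:R * N%:R * x - b)) else 0.
Proof.
move=> k0.
have ci a : mu.-integrable I (EFin \o (fun t => cos (k%:R * t + a) * cos (j%:R * t + b))).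
  by apply: continuous_integrable => t; apply: cvgM; exact: continuous_cos_lin.
under eq_Rintegral do rewrite err_coef_lin mulrBl.
rewrite RintegralB// !Rintegral_cosM//.
by case: eqP => _; rewrite ?subrr// -mulrBr.
Qed.

Lemma Rintegral_err_partialM M x T : continuous T ->
  \int[mu]_(t in I) (err_partial alpha r beta n M x t * T t) =
  \sum_(1 <= k < M) c k * \int[mu]_(t in I) (err_coef beta n x t k * T t).
Proof.
move=> cT.
have ci k : mu.-integrable I (EFin \o (fun t => err_coef beta n x t k * T t)).
  by apply: continuous_integrable => t; apply: cvgM; [exact: continuous_err_coef|exact: cT].
have mI : measurable (I : set (measurableTypeR R)) by exact: measurable_itv.
have [_ e] := @Rintegral_sum R (index_iota 1 M)
  (fun k t => c k * (err_coef beta n x t k * T t)) (fun k => integrableZl mI (c k) (ci k)).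
transitivity (\int[mu]_(t in I) \sum_(1 <= k < M) c k * (err_coef beta n x t k * T t)).
  apply: eq_Rintegral => t _; rewrite /err_partial mulr_suml.
  by apply: eq_bigr => k _; rewrite mulrA.
by rewrite e; apply: eq_bigr => k _; rewrite RintegralZl.
Qed.

(** The coefficients of index below n vanish, and as functions of t the others have frequency k >=
    n, orthogonal to T. *)
Lemma Rintegral_err_partial_trig_poly M x T : trig_poly n.-1 T ->
  \int[mu]_(t in I) (err_partial alpha r beta n M x t * T t) = 0.
Proof.
move=> hT; rewrite Rintegral_err_partialM; last exact: trig_poly_continuous hT.
rewrite big_nat_cond big1// => k /andP[/andP[k0 _] _].
have [kn|nk] := ltnP k n.
  under eq_Rintegral do rewrite err_coef_small// mul0r.
  by rewrite Rintegral_cst_pi mul0r mulr0.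
(* Continuity is carried through the induction, since linearity of the integral requires integrable
   parts. *)
suff [_ ->] : continuous T /\ \int[mu]_(t in I) (err_coef beta n x t k * T t) = 0.
  by rewrite mulr0.
have ci T1 : continuous T1 -> mu.-integrable I (EFin \o (fun t => err_coef beta n x t k * T1 t)).
  by move=> cT; apply: continuous_integrable => t; apply: cvgM; [exact: continuous_err_coef|exact: cT].
have mI : measurable (I : set (measurableTypeR R)) by exact: measurable_itv.
move: T hT; apply: trig_poly_ind.
- move=> T1 T2 [c1 h1] [c2 h2]; split.
    by move=> t; apply: cvgD; [exact: c1|exact: c2].
  under eq_Rintegral do rewrite /= mulrDr.
  by rewrite RintegralD ?h1 ?h2 ?addr0//; exact: ci.
- move=> a T [cT h]; split.
    by move=> t; apply: cvgM; [exact: cvg_cst|exact: cT].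
  under eq_Rintegral do rewrite mulrCA.
  by rewrite RintegralZl ?h ?mulr0//; exact: ci.
- move=> j eta jn; split; first exact: continuous_cos_lin.
  by rewrite Rintegral_err_coef_cosM// ifN//; apply/eqP; move: jn nk n0; lia.
Qed.

(** Subtracting T from phi leaves the integral unchanged; the uniform bound on the kernel then
    applies. *)
Lemma Rintegral_err_partial_le M x phi T : 4 <= alpha * r * n%:R `^ r ->
  L1 phi -> trig_poly n.-1 T ->
  `|\int[mu]_(t in I) (err_partial alpha r beta n M x t * phi t)| <=
  2 * `|sin (N%:R / 2 * x)| * (tail_main alpha r n * (1 + 4 * tail_error alpha r n))
  * norm1 (phi \- T).
Proof.
move=> an lphi hT; set B := 2 * _ * _.
have mI : measurable (I : set (measurableTypeR R)) by exact: measurable_itv.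
have hB t : `|err_partial alpha r beta n M x t| <= B by exact: norm_err_partial_le.
have lT := trig_poly_L1 hT; have lB := L1B lphi lT.
have ci f : L1 f -> mu.-integrable I (EFin \o (fun t => err_partial alpha r beta n M x t * f t)).
  move=> lf; have [|||] // := @bounded_cvg_Rintegral R I (fun=> err_partial alpha r beta n M x)
     (err_partial alpha r beta n M x) f B (measurable_itv _) (periodic_integrable lf).
    move=> _; apply: measurable_funTS; apply: continuous_measurable_fun.
    exact: continuous_err_partial.
  by move=> t; exact: cvg_cst.
have -> : \int[mu]_(t in I) (err_partial alpha r beta n M x t * phi t) =
    \int[mu]_(t in I) (err_partial alpha r beta n M x t * (phi t - T t)).
  under [RHS]eq_Rintegral do rewrite mulrBr.
  by rewrite (RintegralB mI (ci _ lphi) (ci _ lT)) (Rintegral_err_partial_trig_poly M x hT) subr0.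
apply: (le_trans (le_normr_Rintegral mI (ci _ lB))).
have iN := integrable_norm (periodic_integrable lB).
rewrite periodic_norm1// -RintegralZl//.
apply: le_Rintegral => //.
- exact: (integrable_norm (ci _ lB)).
- exact: (integrableZl mI B iN).
- by move=> t _; rewrite normrM ler_wpM2r.
Qed.

Lemma Rintegral_err_partial_best M x phi : 4 <= alpha * r * n%:R `^ r -> L1 phi ->
  `|\int[mu]_(t in I) (err_partial alpha r beta n M x t * phi t)| <=
  2 * `|sin (N%:R / 2 * x)| * (tail_main alpha r n * (1 + 4 * tail_error alpha r n))
  * best_approx n phi.
Proof.
move=> an lphi; apply: best_approx_ge => [|T hT]; last exact: Rintegral_err_partial_le.
have L0 := tail_main_gt0 r0 alpha0 n0; have Q0 := tail_error_gt0 r0 alpha0 n0.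
apply: mulr_ge0; first by rewrite mulr_ge0.
apply: mulr_ge0; first exact: ltW.
by rewrite addr_ge0// mulr_ge0// ltW.
Qed.

Lemma interp_err_le f phi x : 4 <= alpha * r * n%:R `^ r ->
  L1 phi -> is_gen_deriv alpha r beta f phi ->
  `|interp_err n f x| <= pi^-1 *
   (2 * `|sin (N%:R / 2 * x)| * (tail_main alpha r n * (1 + 4 * tail_error alpha r n))
   * best_approx n phi).
Proof.
move=> an lphi hf; have cv := cvg_norm (@interp_err_cvg R alpha r beta r0 r1 alpha0 n n0 f phi x lphi hf).
apply: (cvgr_to_le (cv _)); apply: nearW => M.
rewrite normrM ger0_norm ?invr_ge0 ?pi_ge0// ler_wpM2l ?invr_ge0 ?pi_ge0//.
exact: Rintegral_err_partial_best.
Qed.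

End ErrCoef.

(** * The extremal function *)

Section Fejer.
Context {R : realType}.
Local Notation mu := (@lebesgue_measure R).
Local Notation I := [set` `[- (pi : R), pi]].
Implicit Types (x t u : R) (M : nat).

(** The Fejer kernel without its constant term 1, so that its mean is zero as required of a
    generalized derivative. *)
Definition fejer M u : R := \sum_(1 <= l < M) 2 * (1 - l%:R / M%:R) * cos (l%:R * u).

(** The right side is the squared modulus of the sum of exp(i j u). Passing to M + 1 adds 1 and
    twice a cross term made of the cos((M - j) u). *)
Lemma fejer_sumsq M u :
  M%:R + \sum_(1 <= l < M) 2 * (M%:R - l%:R) * cos (l%:R * u) =
  (\sum_(0 <= j < M) cos (j%:R * u)) ^+ 2 + (\sum_(0 <= j < M) sin (j%:R * u)) ^+ 2.
Proof.
elim: M => [|M ih]; first by rewrite !big_geq// expr0n addr0.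
have rc (F : nat -> R) : \sum_(0 <= j < M.+1) F j = \sum_(0 <= j < M) F j + F M.
  by rewrite big_nat_recr.
rewrite !rc.
set C := \sum_(0 <= j < M) _ in ih *; set S := \sum_(0 <= j < M) _ in ih *.
have cross : C * cos (M%:R * u) + S * sin (M%:R * u) = \sum_(1 <= l < M.+1) cos (l%:R * u).
  rewrite /C /S !mulr_suml -big_split/= big_add1/= [RHS]big_nat_rev/=.
  rewrite big_nat_cond [RHS]big_nat_cond; apply: eq_bigr => j /andP[/andP[_ jM] _].
  rewrite add0n subnSK// natrB ?(ltnW jM)// mulrBl cosB; ring.
have -> : \sum_(1 <= l < M.+1) 2 * (M.+1%:R - l%:R) * cos (l%:R * u) =
  \sum_(1 <= l < M) 2 * (M%:R - l%:R) * cos (l%:R * u) + 2 * \sum_(1 <= l < M.+1) cos (l%:R * u).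
  have -> : \sum_(1 <= l < M) 2 * (M%:R - l%:R) * cos (l%:R * u) =
     \sum_(1 <= l < M.+1) 2 * (M%:R - l%:R) * cos (l%:R * u).
    case: M {ih rc C S cross} => [|M]; first by rewrite !big_geq.
    by rewrite [RHS]big_nat_recr//= subrr mulr0 mul0r addr0.
  rewrite mulr_sumr -big_split/=; apply: eq_bigr => l _.
  by rewrite -natr1; ring.
rewrite -cross -natr1.
have := cos2Dsin2 (M%:R * u); move: ih => /eqP; rewrite -subr_eq => /eqP ih cs.
set X := \sum_(1 <= l < M) _ in ih *.
have -> : X = C ^+ 2 + S ^+ 2 - M%:R by rewrite -ih; ring.
by rewrite -[X in M%:R + X]cs; ring.
Qed.

Lemma fejer_geN1 M u : (0 < M)%N -> 0 <= fejer M u + 1.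
Proof.
move=> M0; have MP : 0 < M%:R :> R by rewrite ltr0n.
rewrite -(pmulr_rge0 _ MP).
have -> : M%:R * (fejer M u + 1) =
    M%:R + \sum_(1 <= l < M) 2 * (M%:R - l%:R) * cos (l%:R * u).
  rewrite mulrDr mulr1 addrC; congr (_ + _); rewrite mulr_sumr.
  by apply: eq_bigr => l _; field; rewrite gt_eqF.
by rewrite fejer_sumsq addr_ge0// sqr_ge0.
Qed.

Lemma trig_poly_fejer M x : trig_poly M (fun t => fejer M (t - x)).
Proof.
rewrite (_ : (fun t => _) = (fun t => \sum_(l < M) (if (0 < l)%N then
   2 * (1 - l%:R / M%:R) else 0) * cos (l%:R * t + (- l%:R * x)))).
  by apply: trig_poly_sum => l; apply/trig_polyZ/trig_poly_cosn/ltnW.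
apply/funext => t; rewrite /fejer -(big_mkord xpredT (fun l : nat => (if (0 < l)%N then
   2 * (1 - l%:R / M%:R) else 0) * cos (l%:R * t + (- l%:R * x)))).
case: M => [|M]; first by rewrite !big_geq.
rewrite [RHS](big_cat_nat (leq0n 1))//= big_nat1/= mul0r add0r.
rewrite big_nat_cond [RHS]big_nat_cond; apply: eq_bigr => l /andP[/andP[l0 _] _].
by rewrite l0; congr (_ * cos _); ring.
Qed.

Lemma Rintegral_mul_fejer M x (g : R -> R) : continuous g ->
  \int[mu]_(t in I) (g t * fejer M (t - x)) = \sum_(1 <= l < M) 2 * (1 - l%:R / M%:R) *
    \int[mu]_(t in I) (g t * cos (l%:R * t + (- (l%:R * x)))).
Proof.
move=> cg.
have ci (l : nat) : mu.-integrable I (EFin \o (fun t => g t * cos (l%:R * t + (- (l%:R * x))))).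
  by apply: continuous_integrable => t; apply: cvgM; [exact: cg|exact: continuous_cos_lin].
have mI : measurable (I : set (measurableTypeR R)) by exact: measurable_itv.
have [_ e] := @Rintegral_sum R (index_iota 1 M)
  (fun l t => 2 * (1 - l%:R / M%:R) * (g t * cos (l%:R * t + (- (l%:R * x)))))
  (fun l => integrableZl mI _ (ci l)).
transitivity (\int[mu]_(t in I) \sum_(1 <= l < M)
   2 * (1 - l%:R / M%:R) * (g t * cos (l%:R * t + (- (l%:R * x))))).
  apply: eq_Rintegral => t _; rewrite /fejer mulr_sumr.
  by apply: eq_bigr => l _; rewrite mulrCA; congr (_ * (_ * cos _)); ring.
by rewrite e; apply: eq_bigr => l _; rewrite RintegralZl.
Qed.

Lemma Rintegral_fejer M x : \int[mu]_(t in I) fejer M (t - x) = 0.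
Proof.
have := @Rintegral_mul_fejer M x (fun=> 1) (fun t => cvg_cst _).
under eq_Rintegral do rewrite mul1r.
move=> ->; rewrite big_nat_cond big1// => l /andP[/andP[l0 _] _].
by under eq_Rintegral do rewrite mul1r; rewrite Rintegral_cos// mulr0.
Qed.

(** Approximating by the constant -1 leaves a nonnegative function, whose norm is its integral 2
    pi. *)
Lemma best_approx_fejer_le n M x : (0 < M)%N ->
  best_approx n (fun t => fejer M (t - x)) <= pi *+ 2.
Proof.
move=> M0; have hF := trig_poly_fejer M x.
apply: le_trans (best_approx_le _ (trig_poly_cst n.-1 (-1))) _.
rewrite periodic_norm1; last exact: L1B (trig_poly_L1 hF) (trig_poly_L1 (trig_poly_cst 0 _)).
have e t : `|((fun t => fejer M (t - x)) \- (fun=> -1)) t| = fejer M (t - x) + 1.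
  by rewrite /= opprK ger0_norm// fejer_geN1.
under eq_Rintegral do rewrite e.
rewrite RintegralD//.
- by rewrite Rintegral_fejer add0r Rintegral_cst_pi mul1r.
- exact/continuous_integrable/(trig_poly_continuous hF).
- by apply: continuous_integrable => t; exact: cvg_cst.
Qed.
End Fejer.

(** * Phase alignment and the lower bound for the Fejer sum *)

Section Extremal.
Context {R : realType} (alpha r beta : R).
Hypotheses (r0 : 0 < r) (r1 : r < 1) (alpha0 : 0 < alpha).
Local Notation mu := (@lebesgue_measure R).
Local Notation I := [set` `[- (pi : R), pi]].
Local Notation c k := (expR (- alpha * k%:R `^ r)).
Local Notation theta := (beta * pi / 2).
Implicit Types (f g phi T : R -> R) (x t y u : R).
Variable n : nat.
Hypotheses (n0 : (0 < n)%N) (an : 4 <= alpha * r * n%:R `^ r).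
Local Notation N := (2 * n - 1)%N.

Lemma cos_ge1B y : 1 - `|y| <= cos y.
Proof.
wlog y0 : y / 0 <= y => [h|].
  have [|/ltW y0] := leP 0 y; first exact: h.
  by rewrite -cosN -normrN h// oppr_ge0.
rewrite ger0_norm//.
have [|z _ e] := @MVT_segment R cos (fun z => - sin z) 0 y y0 (fun z _ => is_derive_cos z).
  by apply: continuous_subspaceT => z; exact: continuous_cos.
have -> : cos y = 1 + - sin z * (y - 0) by rewrite -e cos0; ring.
by rewrite lerD2l subr0 mulNr lerN2 ler_piMl// sin_le1.
Qed.

(** By orthogonality the integral is a Fejer mean of the error kernel at t0; K <= M ensures that
    every frequency of the Fejer kernel is present. *)
Lemma Rintegral_err_partial_fejer M K x t0 : (K <= M)%N ->
  \int[mu]_(t in I) (err_partial alpha r beta n M x t * fejer K (t - t0)) =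
  pi *+ 2 * \sum_(1 <= k < K) c k * ((1 - k%:R / K%:R) * err_coef beta n x t0 k).
Proof.
move=> KM; rewrite Rintegral_err_partialM; last exact: trig_poly_continuous (trig_poly_fejer K t0).
have term k : (0 < k)%N -> \int[mu]_(t in I) (err_coef beta n x t k * fejer K (t - t0)) =
    if (k < K)%N then pi *+ 2 * ((1 - k%:R / K%:R) * err_coef beta n x t0 k) else 0.
  move=> k0; rewrite Rintegral_mul_fejer; last exact: continuous_err_coef.
  under eq_bigr do rewrite Rintegral_err_coef_cosM//.
  case: ifPn => kK; last first.
    rewrite big_nat_cond big1// => l /andP[/andP[_ lK] _].
    by rewrite ifN ?mulr0//; apply: contraNN kK => /eqP ->.
  rewrite (bigD1_seq k) ?iota_uniq//=; last by rewrite mem_index_iota k0.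
  rewrite big1 ?addr0; last by move=> l lk; rewrite eq_sym (negbTE lk) mulr0.
  rewrite eqxx err_coef_lin; set z := _ * _ * x.
  rewrite (_ : theta - k%:R * x - - (k%:R * t0) = k%:R * t0 + (theta - k%:R * x)); last by ring.
  rewrite (_ : theta - k%:R * x + z - - (k%:R * t0) = k%:R * t0 + (theta - k%:R * x + z)); last by ring.
  by rewrite -[pi *+ 2]mulr_natl; ring.
have [K1|K1] := leqP K 1.
  rewrite [in RHS]big_geq// mulr0 big_nat_cond big1// => k /andP[/andP[k0 _] _].
  by rewrite term// ltnNge (leq_trans K1)// mulr0.
rewrite (big_cat_nat (ltnW K1) KM)/= [X in _ + X]big_nat_cond [X in _ + X]big1 ?addr0; last first.
  move=> k /andP[/andP[Kk _] _]; rewrite term ?(leq_trans _ Kk) ?(ltnW K1)//.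
  by rewrite ltnNge Kk mulr0.
rewrite mulr_sumr big_nat_cond [RHS]big_nat_cond; apply: eq_bigr => k /andP[/andP[k0 kK] _].
by rewrite term// kK mulrCA.
Qed.

(* The point [x - u] is where the phases of the leading terms align *)
Lemma aligned_phase x : exists u, forall k, (n <= k)%N ->
  sin (N%:R / 2 * x) != 0 ->
  1 - 8 * (k%:R / n%:R - 1) <= err_coef beta n x (x - u) k / (2 * sin (N%:R / 2 * x)).
Proof.
have nP : 0 < n%:R :> R by rewrite ltr0n.
have pi2 : 0 < pi *+ 2 :> R by rewrite pmulrn_lgt0 ?pi_gt0.
(* With u = v / n and v congruent to A modulo 2 pi, the term k = n has alias 1 and first sine -1, so
   its quotient is 1. The constant 8 bounds v <= 2 pi. *)
pose A := theta + N%:R / 2 * x - pi / 2.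
pose z := Num.floor (A / (pi *+ 2)).
pose v := A - z%:~R * (pi *+ 2).
have v0 : 0 <= v by rewrite subr_ge0 -ler_pdivlMr// floor_le.
have v8 : v <= 8.
  have : v <= pi *+ 2.
    rewrite lerBlDr -{1}[pi *+ 2]mul1r -mulrDl -ler_pdivrMr// ltW//.
    by have := floorD1_gt (A / (pi *+ 2)); rewrite intrD addrC.
  move=> /le_trans; apply.
  by have := @pihalf_lt2 R; rewrite -mulr_natl; lra.
exists (v / n%:R) => k nk s0.
set s := sin (N%:R / 2 * x) in s0 *.
set d : R := k%:R / n%:R - 1.
have d0 : 0 <= d by rewrite subr_ge0 ler_pdivlMr// mul1r ler_nat.
have dE : k%:R = n%:R * (d + 1) :> R by rewrite /d subrK mulrC divfK ?gt_eqF.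
rewrite err_coefE; move m1 : (alias n k) => m.
(* For m = 1 the quotient is cos(d v) >= 1 - 8 d. For m >= 2 its modulus is only known to be at most
   m <= d + 1, which suffices because d >= 1. *)
have [mle1|m2] := leqP m 1.
  have m0 : m = 1%N.
    by apply/eqP; rewrite eqn_leq mle1 -m1 alias_gt0.
  rewrite m0 !mul1r (_ : x - (x - v / n%:R) = v / n%:R); last by ring.
  rewrite (_ : sin _ = - cos (d * v)).
    rewrite mulrNN mulrAC [X in _ <= X](_ : _ = cos (d * v)); last by rewrite -/s; field.
    apply: le_trans (cos_ge1B _).
    by rewrite lerD2l lerN2 ger0_norm ?mulr_ge0// mulrC ler_wpM2r.
  have -> : k%:R * (v / n%:R) - theta - N%:R / 2 * x = d * v - pi / 2 + (- z)%:~R * (pi *+ 2).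
    by rewrite dE mulrNz /v /A; field; rewrite gt_eqF.
  by rewrite sinD2piz sinBpihalf.
have kn : 2 * n%:R <= k%:R :> R.
  rewrite -natrM ler_nat; apply: leq_trans (alias_muln_le n0 nk).
  by rewrite m1 leq_mul2r m2 orbT.
have d1 : 1 <= d by rewrite lerBrDr ler_pdivlMr//; have := kn; lra.
have mk : m%:R <= d + 1.
  rewrite /d subrK ler_pdivlMr// -natrM ler_nat -m1; exact: alias_muln_le.
apply: (@le_trans _ _ (- (d + 1))); first by lra.
rewrite lerNl (le_trans (ler_norm _))// normrN.
set a := sin _; set b := sin (m%:R * _).
have -> : - 2 * a * b / (2 * s) = - (a * b / s) by field.
rewrite normrN [`|_ / _|]normrM normfV ler_pdivrMr ?normr_gt0// normrM.
apply: (@le_trans _ _ (1 * (m%:R * `|s|))).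
  by rewrite ler_pM// ?sin_max// norm_sin_natmul.
by rewrite mul1r ler_wpM2r.
Qed.

(** The sum is at least 9 times the plain tail minus 8 + 1 / n times the weighted one. Since 1 / n
    <= Q and 1 / n <= 1, the relative loss is at most 32 Q + Q + 4 Q = 37 Q. *)
Lemma fejer_sum_ge x : sin (N%:R / 2 * x) != 0 -> exists u,
  tail_main alpha r n * (1 - 37 * tail_error alpha r n) <=
  (\sum_(1 <= k < n * n) c k * ((1 - k%:R / (n * n)%:R) * err_coef beta n x (x - u) k))
   / (2 * sin (N%:R / 2 * x)).
Proof.
move=> s0; have [u hu] := aligned_phase x; exists u.
have nP : 0 < n%:R :> R by rewrite ltr0n.
have n1 : 1 <= n%:R :> R by rewrite ler1n.
have nnP : (0 < n * n)%N by rewrite muln_gt0 n0.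
have nn : (n <= n * n)%N by rewrite leq_pmulr.
have L0 := tail_main_gt0 r0 alpha0 n0; have Q0 := tail_error_gt0 r0 alpha0 n0.
set L := tail_main alpha r n in L0 *; set Q := tail_error alpha r n in Q0 *.
(* The first summand of Q is alpha r n^r / n, and alpha r n^r >= 1. *)
have nQ : n%:R^-1 <= Q.
  have b0 : 0 < n%:R `^ (1 - r) by rewrite powR_gt0.
  have a0 : 0 < alpha * r * n%:R `^ r by rewrite (lt_le_trans _ an).
  apply: ler_wpDr; first by rewrite divr_ge0// ltW.
  rewrite -[n%:R^-1]mul1r ler_pdivlMr// mulrAC ler_pdivrMr// mul1r.
  have -> : alpha * r * n%:R = alpha * r * n%:R `^ r * n%:R `^ (1 - r).
    rewrite -[RHS]mulrA -powRD ?(gt_eqF nP) ?implybT// (_ : r + (1 - r) = 1); last by ring.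
    by rewrite powRr1// ltW.
  by rewrite ler_peMl ?(ltW b0)// (le_trans _ an)// ler1n.
apply/ler_addgt0Pr => e e0.
have [L1 hL1] := tail_sum_cvg_ge r0 r1 alpha0 n0 an (divr_gt0 e0 (ltr0n _ 9)).
pose K := maxn L1 (n * n).
have {}hL1 := hL1 K (leq_maxl _ _).
have hL2 := sum_weighted_le r0 alpha0 n0 an K.
(* With y = k / n >= 1, b k is at most (1 - y / n) (1 - 8 (y - 1)), and it is nonpositive once k >=
   n^2. Hence the sum of the c k * b k may run up to K, beyond the order of the Fejer kernel. *)
pose b k : R := 9 - (8 + n%:R^-1) * (k%:R / n%:R).
have h1 : \sum_(n <= k < K) c k * b k <= (\sum_(1 <= k < n * n) c k *
    ((1 - k%:R / (n * n)%:R) * err_coef beta n x (x - u) k)) / (2 * sin (N%:R / 2 * x)).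
  rewrite mulr_suml (big_cat_nat nn (leq_maxr _ _))/= (big_cat_nat n0 nn)/=.
  rewrite [X in _ <= X + _]big_nat_cond [X in _ <= X + _]big1 ?add0r; last first.
    by move=> k /andP[/andP[_ kn] _]; rewrite err_coef_small// !mulr0 mul0r.
  rewrite -[leRHS]addr0 lerD//.
    rewrite big_nat_cond [leRHS]big_nat_cond; apply: ler_sum => k /andP[/andP[nk kn] _].
    rewrite -[leRHS]mulrA ler_pM2l ?expR_gt0// -[leRHS]mulrA.
    have := hu _ nk s0; set q := err_coef _ _ _ _ _ / _ => hq.
    have knn : k%:R / (n * n)%:R = n%:R^-1 * (k%:R / n%:R) :> R.
      by rewrite natrM; field; rewrite gt_eqF.
    have s1 : 0 <= 1 - k%:R / (n * n)%:R :> R.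
      by rewrite subr_ge0 ler_pdivrMr ?ltr0n// mul1r ler_nat ltnW.
    apply: le_trans (ler_wpM2l s1 hq).
    rewrite /b mulrDl -knn.
    have k1 : 0 <= k%:R / n%:R - 1 :> R by rewrite subr_ge0 ler_pdivlMr// mul1r ler_nat.
    have s2 : 0 <= k%:R / (n * n)%:R :> R by rewrite divr_ge0.
    move: (k%:R / (n * n)%:R) (k%:R / n%:R) s1 s2 k1 => s y _ s2 k1.
    rewrite -subr_ge0.
    have -> : (1 - s) * (1 - 8 * (y - 1)) - (9 - (8 * y + s)) = 8 * (s * (y - 1)) by ring.
    by rewrite mulr_ge0// mulr_ge0.
  rewrite big_nat_cond; apply: sumr_le0 => k /andP[/andP[nk _] _].
  rewrite mulr_ge0_le0 ?expR_ge0// /b.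
  have y1 : n%:R <= k%:R / n%:R :> R by rewrite ler_pdivlMr// -natrM ler_nat.
  have y2 : 1 <= n%:R^-1 * (k%:R / n%:R) :> R by rewrite mulrC ler_pdivlMr// mul1r.
  by rewrite mulrDl; lra.
rewrite -lerBlDr; apply: le_trans h1.
have -> : \sum_(n <= k < K) c k * b k = 9 * \sum_(n <= k < K) c k -
    (8 + n%:R^-1) * \sum_(n <= k < K) k%:R / n%:R * c k.
  by rewrite !mulr_sumr -sumrB; apply: eq_bigr => k _; rewrite /b; ring.
have i0 : 0 <= n%:R^-1 :> R by rewrite invr_ge0.
have i1 : n%:R^-1 <= 1 :> R by rewrite invf_le1.
have h8 : 0 <= 8 + n%:R^-1 :> R by rewrite addr_ge0.
have h3 := ler_wpM2l h8 hL2.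
have h2 : 9 * (L - e / 9) <= 9 * \sum_(n <= k < K) c k by rewrite ler_pM2l.
apply: le_trans (lerB h2 h3).
rewrite -/L -/Q -subr_ge0.
have -> : 9 * (L - e / 9) - (8 + n%:R^-1) * (L * (1 + 4 * Q)) - (L * (1 - 37 * Q) - e) =
  L * (Q - n%:R^-1) + 4 * (L * Q * (1 - n%:R^-1)) by field; rewrite gt_eqF.
have [L2 Q2] : 0 <= L /\ 0 <= Q by split; exact: ltW.
apply: addr_ge0; first by rewrite mulr_ge0// subr_ge0.
by apply: mulr_ge0 => //; rewrite mulr_ge0 ?subr_ge0// mulr_ge0.
Qed.

End Extremal.

(** * The extremal function and the form of the remainder *)

Section ExtremalFunction.
Context {R : realType} (alpha r beta : R).
Hypotheses (r0 : 0 < r) (r1 : r < 1) (alpha0 : 0 < alpha).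
Local Notation mu := (@lebesgue_measure R).
Local Notation I := [set` `[- (pi : R), pi]].
Implicit Types (f g phi T : R -> R) (x t y u : R).

Lemma poisson_kernel_periodic : periodic (poisson_kernel alpha r beta) (pi *+ 2).
Proof.
move=> y; rewrite /poisson_kernel; congr (lim (_ @ \oo)); apply/funext => M.
apply: eq_bigr => k _; congr (_ * _).
rewrite (_ : _ - _ = k%:R * y - beta * pi / 2 + (k%:Z)%:~R * (pi *+ 2)).
  by rewrite cosD2piz.
by rewrite -pmulrn; ring.
Qed.

Lemma gen_deriv_conv phi : L1 phi -> \int[mu]_(t in I) phi t = 0 ->
  let F x := pi^-1 * \int[mu]_(t in I) (poisson_kernel alpha r beta (x - t) * phi t) in
  poisson_class alpha r beta L1 F /\ is_gen_deriv alpha r beta F phi.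
Proof.
move=> lphi phi0 F.
have h : is_gen_deriv alpha r beta F phi.
  by split=> //; exists 0 => x; rewrite mul0r add0r.
split=> //; split; last by exists phi.
move=> x; rewrite /F; congr (_ * _); apply: eq_Rintegral => t _.
by rewrite addrAC poisson_kernel_periodic.
Qed.

Variable n : nat.
Hypotheses (n0 : (0 < n)%N) (an : 4 <= alpha * r * n%:R `^ r).
Local Notation N := (2 * n - 1)%N.
Local Notation L := (tail_main alpha r n).
Local Notation Q := (tail_error alpha r n).

(** The Fejer kernel centred at the aligned point is scaled to best approximation E. Unscaled, its
    best approximation is at most 2 pi, so the factor a is at least E / (2 pi). *)
Lemma extremal_exists x (E : R) : 0 < E -> sin (N%:R / 2 * x) != 0 ->
  0 < 1 - 37 * Q ->
  exists F Phi, [/\ poisson_class alpha r beta L1 F, is_gen_deriv alpha r beta F Phi,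
    best_approx n Phi = E &
    2 / pi * `|sin (N%:R / 2 * x)| * E * L * (1 - 37 * Q) <= `|interp_err n F x|].
Proof.
move=> E0 s0 hQ.
have L0 := tail_main_gt0 r0 alpha0 n0.
have p0 := @pi_gt0 R.
have nn : (0 < n * n)%N by rewrite muln_gt0 n0.
have [u hu] := fejer_sum_ge beta r0 r1 alpha0 n0 an s0.
move: hu; set s := sin _ in s0 *; set S := \sum_(1 <= k < n * n) _ => hu.
have LQ : 0 < L * (1 - 37 * Q) by rewrite mulr_gt0.
have V0 : 0 < S / (2 * s) by exact: lt_le_trans hu.
pose g t := fejer (n * n) (t - (x - u)).
have tg : trig_poly (n * n) g := trig_poly_fejer _ _.
have lg := trig_poly_L1 tg.
have intg M : (n * n <= M)%N ->
    \int[mu]_(t in I) (err_partial alpha r beta n M x t * g t) = pi *+ 2 * S.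
  exact: Rintegral_err_partial_fejer.
have S0 : S != 0.
  by apply: contraTneq V0 => ->; rewrite mul0r ltxx.
have Eg_le : best_approx n g <= pi *+ 2 by exact: best_approx_fejer_le.
(* Were it zero, the upper bound would annihilate the integral, which equals 2 pi S with S
   nonzero. *)
have Eg0 : 0 < best_approx n g.
  rewrite lt_neqAle best_approx_ge0 andbT; apply: contraTneq isT => e.
  have := @Rintegral_err_partial_best R alpha r beta r0 r1 alpha0 n n0 (n * n) x g an lg.
  rewrite -e mulr0 normr_le0 intg// mulf_eq0 (negbTE S0) orbF.
  by rewrite gt_eqF// pmulrn_lgt0.
pose a := E / best_approx n g.
have a0 : 0 < a by rewrite divr_gt0.
pose Phi t := a * g t.
have mI : measurable (I : set (measurableTypeR R)) by exact: measurable_itv.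
have lPhi : L1 Phi by exact: (trig_poly_L1 (trig_polyZ a tg)).
have Phi0 : \int[mu]_(t in I) Phi t = 0.
  rewrite RintegralZl ?Rintegral_fejer ?mulr0//; exact: periodic_integrable.
have [hF1 hF2] := gen_deriv_conv lPhi Phi0.
set F := (fun x => _) in hF1 hF2.
exists F, Phi; split=> //.
  by rewrite best_approxZ// /a divfK// gt_eqF.
have cg : continuous g := trig_poly_continuous tg.
have -> : interp_err n F x = pi^-1 * (a * (pi *+ 2 * S)).
  have cv := @interp_err_cvg R alpha r beta r0 r1 alpha0 n n0 F Phi x lPhi hF2.
  apply: (cvg_unique _ cv) => //.
  (* The truncated integrals are independent of M once M >= n^2, so this common value is the
     limit. *)
  apply: cvg_near_cst; near=> M.
  rewrite -(intg M); last by near: M; exact: nbhs_infty_ge.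
  rewrite -RintegralZl//.
    by congr (_ * _); apply: eq_Rintegral => t _; rewrite /Phi mulrCA.
  apply: continuous_integrable => t; apply: cvgM; last exact: cg.
  exact: continuous_err_partial.
have -> : `|pi^-1 * (a * (pi *+ 2 * S))| = 2 * a * `|S|.
  have pi2 : 0 < pi *+ 2 :> R by rewrite pmulrn_lgt0.
  rewrite normrM [`|a * _|]normrM [`|_ * S|]normrM normfV.
  rewrite (gtr0_norm a0) (gtr0_norm p0) (gtr0_norm pi2).
  have aux (p b w : R) : 0 < p -> p^-1 * (b * (p *+ 2 * w)) = 2 * b * w.
    by move=> pp; rewrite -mulr_natl; field; rewrite gt_eqF.
  exact: aux.
have sS : `|S| = 2 * `|s| * (S / (2 * s)).
  rewrite -(gtr0_norm V0) normrM normfV normrM normr_nat mulrC divfK//.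
  by rewrite mulf_neq0 ?normr_eq0// pnatr_eq0.
rewrite sS.
have sp : 0 < `|s| by rewrite normr_gt0.
have a2 : 0 < 2 * a by rewrite mulr_gt0.
have s2 : 0 < 2 * `|s| by rewrite mulr_gt0.
apply: (@le_trans _ _ (2 * a * (2 * `|s| * (L * (1 - 37 * Q))))); last first.
  by rewrite ler_pM2l// ler_pM2l.
have ha : E / pi <= 2 * a.
  rewrite ler_pdivrMr// (_ : 2 * a * pi = E * (pi *+ 2 / best_approx n g)).
    by apply: ler_peMr; [exact: ltW|rewrite ler_pdivlMr// mul1r].
  by rewrite /a -[pi *+ 2]mulr_natl; ring.
have -> : 2 / pi * `|s| * E * L * (1 - 37 * Q) = E / pi * (2 * `|s| * (L * (1 - 37 * Q))).
  by ring.
by rewrite ler_pM2r// mulr_gt0.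
Unshelve. all: by end_near. Qed.

(** The target form equals W (1 + pi gamma Q) with W the leading factor. Solving for gamma gives
    |gamma| <= 37 / pi, well below 20 pi^4. *)
Lemma remainder_form (s E v : R) : 0 <= s -> 0 <= E ->
  2 / pi * s * E * L * (1 - 37 * Q) <= v -> v <= 2 / pi * s * E * L * (1 + 4 * Q) ->
  exists gamma : R, `|gamma| < 20 * pi ^+ 4 /\
    v = 2 * expR (- alpha * n%:R `^ r) * n%:R `^ (1 - r) * s
         * (1 / (pi * alpha * r)
            + gamma * (1 / (alpha * r) ^+ 2 * (1 / n%:R `^ r) + 1 / n%:R `^ (1 - r))) * E.
Proof.
move=> s0 E0 hl hu.
have L0 := tail_main_gt0 r0 alpha0 n0.
have Q0 := tail_error_gt0 r0 alpha0 n0.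
have p2 := @pi_ge2 R.
have p0 := @pi_gt0 R.
have nP : 0 < n%:R :> R by rewrite ltr0n.
have p4 : 16 <= pi ^+ 4 :> R.
  by rewrite (_ : 16 = 2 ^+ 4 :> R) -?natrX// natrX lerXn2r// nnegrE ltW.
have form gamma : 2 * expR (- alpha * n%:R `^ r) * n%:R `^ (1 - r) * s
         * (1 / (pi * alpha * r)
            + gamma * (1 / (alpha * r) ^+ 2 * (1 / n%:R `^ r) + 1 / n%:R `^ (1 - r))) * E
   = 2 / pi * s * E * L * (1 + pi * gamma * Q).
  have b0 : 0 < n%:R `^ (1 - r) by rewrite powR_gt0.
  have a0 : 0 < n%:R `^ r by rewrite powR_gt0.
  rewrite /tail_main /tail_error.
  move: (pi : R) (p0) => p pp.
  move: (expR (- alpha * n%:R `^ r)) (n%:R `^ (1 - r)) b0 (n%:R `^ r) a0 => e q b0 q2 a0.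
  by field; rewrite !gt_eqF.
set W := 2 / pi * s * E * L in form hl hu.
have W0 : 0 <= W.
  by rewrite /W mulr_ge0 ?(ltW L0)// mulr_ge0// mulr_ge0// divr_ge0// ltW.
(* If W = 0 the two bounds force v = 0, and gamma = 0 will do. *)
have [W00|Wn0] := eqVneq W 0.
  exists 0; rewrite normr0 form W00 mul0r; split; first by rewrite mulr_gt0// exprn_gt0.
  by move: hl hu; rewrite W00 !mul0r => h1 h2; apply/eqP; rewrite eq_le h1 h2.
have Wp : 0 < W by rewrite lt_neqAle eq_sym Wn0.
exists ((v / W - 1) / (pi * Q)); split; last first.
  have aux (w p q : R) : w != 0 -> p != 0 -> q != 0 ->
      v = w * (1 + p * ((v / w - 1) / (p * q)) * q) by move=> *; field; exact/and3P.
  by rewrite form; apply: aux => //; exact: lt0r_neq0.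
rewrite normrM normfV (gtr0_norm (mulr_gt0 p0 Q0)) ltr_pdivrMr ?mulr_gt0//.
have h1 : v / W - 1 <= 4 * Q by rewrite lerBlDl ler_pdivrMr// mulrC.
have h2 : - (37 * Q) <= v / W - 1 by rewrite lerBrDl ler_pdivlMr// mulrC.
have h3 : `|v / W - 1| <= 37 * Q.
  by rewrite ler_norml h2 (le_trans h1)// ler_pM2r// ler_nat.
apply: (le_lt_trans h3).
rewrite mulrA ltr_pM2r//.
apply: (@lt_le_trans _ _ (20 * 16 * 2)); first by rewrite -!natrM ltr_nat.
by rewrite !ler_pM.
Qed.

End ExtremalFunction.

(** * Assembly of the upper and lower bounds *)

Theorem mainTheorem2 (R : realType) (alpha r beta : R)
    (hr0 : 0 < r) (hr1 : r < 1) (halpha : 0 < alpha) :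
  (forall (n : nat) (x : R) (f phi : R -> R),
     (0 < n)%N -> (n_star alpha r <= n)%N ->
     poisson_class alpha r beta L1 f ->
     is_gen_deriv alpha r beta f phi ->
     exists gamma : R, `|gamma| < 20 * pi ^+ 4 /\
       `|interp_err n f x| <=
         2 * expR (- alpha * n%:R `^ r) * n%:R `^ (1 - r)
         * `|sin ((2 * n%:R - 1) / 2 * x)|
         * (1 / (pi * alpha * r)
            + gamma * (1 / (alpha * r) ^+ 2 * (1 / n%:R `^ r)
                       + 1 / n%:R `^ (1 - r)))
         * best_approx n phi)
  /\
  (forall (n : nat) (x : R) (f phi : R -> R),
     (0 < n)%N -> (n_star alpha r <= n)%N ->
     poisson_class alpha r beta L1 f ->
     is_gen_deriv alpha r beta f phi ->
     exists F Phi : R -> R,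
       [/\ poisson_class alpha r beta L1 F,
           is_gen_deriv alpha r beta F Phi,
           best_approx n Phi = best_approx n phi &
           exists gamma : R, `|gamma| < 20 * pi ^+ 4 /\
             `|interp_err n F x| =
               2 * expR (- alpha * n%:R `^ r) * n%:R `^ (1 - r)
               * `|sin ((2 * n%:R - 1) / 2 * x)|
               * (1 / (pi * alpha * r)
                  + gamma * (1 / (alpha * r) ^+ 2 * (1 / n%:R `^ r)
                             + 1 / n%:R `^ (1 - r)))
               * best_approx n phi]).
Proof.
have upper n x f phi : (0 < n)%N -> 4 <= alpha * r * n%:R `^ r ->
    is_gen_deriv alpha r beta f phi ->
    `|interp_err n f x| <= 2 / pi * `|sin ((2 * n%:R - 1) / 2 * x)| * best_approx n phi
      * tail_main alpha r n * (1 + 4 * tail_error alpha r n).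
  move=> n0 an hf; have [lphi _ _] := hf.
  have := interp_err_le hr0 hr1 halpha n0 x an lphi hf.
  by rewrite natr_nodes//; congr (_ <= _); ring.
split=> n x f phi n0 /(n_star_ge4 hr0 hr1 halpha) an cf hf.
  have E0 := best_approx_ge0 n phi.
  have L0 := tail_main_gt0 hr0 halpha n0; have Q0 := tail_error_gt0 hr0 halpha n0.
  have p0 := @pi_gt0 R.
  (* The majorant itself is put into the required form; its lower bound reduces to 1 - 37 Q <= 1 + 4
     Q. *)
  have [|gamma [hg e]] := @remainder_form R alpha r hr0 halpha n n0
    `|sin ((2 * n%:R - 1) / 2 * x)| _ _ (normr_ge0 _) E0 _ (lexx _).
    apply: ler_wpM2l; last by move: Q0; move: (tail_error _ _ _) => q q0; lra.
    by rewrite mulr_ge0 ?(ltW L0)// mulr_ge0// mulr_ge0// divr_ge0// ltW.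
  by exists gamma; split=> //; rewrite -e; exact: upper.
(* If f already meets the lower bound it serves as F; this covers every case in which that bound is
   not positive. *)
have [hW|] := leP (2 / pi * `|sin ((2 * n%:R - 1) / 2 * x)| * best_approx n phi
      * tail_main alpha r n * (1 - 37 * tail_error alpha r n)) `|interp_err n f x|.
  exists f, phi; split=> //.
  exact: remainder_form (normr_ge0 _) (best_approx_ge0 _ _) hW (upper _ _ _ _ n0 an hf).
(* Otherwise the bound is strictly positive, which makes each of its factors nonzero and supplies
   the hypotheses of the construction. *)
move=> /(le_lt_trans (normr_ge0 _)) W0.
have E0 : 0 < best_approx n phi.
  rewrite lt_neqAle best_approx_ge0 andbT; apply: contraTneq W0 => <-.
  by rewrite mulr0 !mul0r ltxx.
have s0 : sin ((2 * n%:R - 1) / 2 * x) != 0.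
  by apply: contraTneq W0 => ->; rewrite normr0 mulr0 !mul0r ltxx.
have hQ : 0 < 1 - 37 * tail_error alpha r n.
  move: W0; rewrite pmulr_rgt0//; apply: mulr_gt0; last exact: tail_main_gt0.
  by rewrite mulr_gt0// mulr_gt0 ?normr_gt0// divr_gt0 ?pi_gt0.
rewrite -natr_nodes// in s0 *.
have [F [Phi [cF hF eF lF]]] := extremal_exists beta hr0 hr1 halpha n0 an E0 s0 hQ.
exists F, Phi; split=> //.
apply: remainder_form lF _ => //; first exact: ltW.
by rewrite -eF natr_nodes//; exact: upper.
Qed.
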